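(* Let $F\in\mathrm{Sym}^4(V^* )$ be a stable ternary quartic form such that $I_{12}(F)\neq 0$, let $F'\in Z$ be a form that is $\mathrm{SL}(V)$-equivalent to $F$, and let $(b_8,b_4,b_0)=\ell^*(F')$ be the corresponding triple of binary forms, with joint invariants $j(\ell^*(F'))$ ($j$ running over all joint invariants). Then these values determine a unique triple up to the action of $\mathrm{SL}(W)$: if $(b_8',b_4',b_0')\in\mathrm{Sym}^8(W^* )\oplus\mathrm{Sym}^4(W^* )\oplus\mathrm{Sym}^0(W^* )$ satisfies $j(b_8',b_4',b_0')=j(b_8,b_4,b_0)$ for all joint invariants $j$, then there is $T\in\mathrm{SL}(W)$ with $(b_8',b_4',b_0')=(b_8,b_4,b_0).T$.
   Context: $K$ is an algebraically closed field of characteristic $0$. $V$ is a $3$-dimensional $K$-vector space with basis $v_1,v_2,v_3$ and dual basis $x_1,x_2,x_3$ of $V^*$; $W$ is $2$-dimensional with dual coordinates $z_1,z_2$. $\mathrm{Sym}^n(V^* )$ is the space of degree $n$ forms in $x_1,x_2,x_3$, $\mathrm{Sym}^r(V)$ that of degree $r$ forms in $v_1,v_2,v_3$. Actions: $\mathrm{GL}(V)$ acts on the right on $\mathrm{Sym}^n(V^* )$ by $F.T=F\circ T$. $\mathrm{SL}(W)$ acts on binary forms on the right by substitution: $T=\begin{pmatrix}a&b\\c&d\end{pmatrix}$ sends $z_1\mapsto az_1+bz_2$, $z_2\mapsto cz_1+dz_2$; it acts diagonally on triples, trivially on $\mathrm{Sym}^0(W^* )=K$. A ternary quartic form $F$ is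 stable if it lies in the stable locus for the action of $\mathrm{SL}(V)$ on $\mathrm{Sym}^4(V^* )$ in the sense of geometric invariant theory (closed orbit and finite stabilizer); by Mumford this holds exactly when the plane curve $F=0$ is reduced and has at worst ordinary double points and (ordinary) cusps as singularities. A contravariant of ternary quartics of degree $d$ and order $r$ is an $\mathrm{SL}(V)$-equivariant homogeneous polynomial map $\mathrm{Sym}^4(V^* )\to\mathrm{Sym}^r(V)$ of degree $d$. Let $\psi$ be Salmon's contravariant of degree 3 and order 6: up to a fixed non-zero constant (immaterial here), $\psi(F)=v_3^{-6}(q_0q_2q_4+2q_1q_2q_3-q_0q_3^2-q_1^2q_4-q_2^3)$, where $v_3^4F(s,t,-(v_1s+v_2t)/v_3)=q_0s^4+4q_1s^3t+6q_2s^2t^2+4q_3st^3+q_4t^4$. Let $\rho(F)=\frac1{144}F(\partial_{v_1},\partial_{v_2},\partial_{v_3})\,\psi(F)$; this is the (up to scalar unique non-zero) contravariant of degree 4 and order 2. Let $I_{12}(F)$ be the determinant of one half of the matrix of second partial derivatives of $\rho(F)$ with respect to $v_1,v_2,v_3$. Let $Z=\{F\in\mathrm{Sym}^4(V^* ):\rho(F)=u(F)\,(v_2^2-v_1v_3)\text{ for some }u(F)\in K^*\}$. Every $F$ with $I_{12}(F)\neq0$ is $\mathrm{SL}(V)$-equivalent to an element of $Z$. $\ell^*:\mathrm{Sym}^4(V^* )\to\mathrm{Sym}^8(W^* )\oplus\mathrm{Sym}^4(W^* )\oplus\mathrm{Sym}^0(W^* )$ is the linear isomorphism given by $x_1^4\mapsto(z_1^8,0,0)$;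 $x_1^3x_2\mapsto(2z_1^7z_2,0,0)$; $x_1^3x_3\mapsto(z_1^6z_2^2,-\frac3{14}z_1^4,0)$; $x_1^2x_2^2\mapsto(4z_1^6z_2^2,\frac17z_1^4,0)$; $x_1^2x_2x_3\mapsto(2z_1^5z_2^3,-\frac27z_1^3z_2,0)$; $x_1^2x_3^2\mapsto(z_1^4z_2^4,-\frac27z_1^2z_2^2,\frac1{30})$; $x_1x_2^3\mapsto(8z_1^5z_2^3,\frac67z_1^3z_2,0)$; $x_1x_2^2x_3\mapsto(4z_1^4z_2^4,-\frac17z_1^2z_2^2,-\frac1{30})$; $x_1x_2x_3^2\mapsto(2z_1^3z_2^5,-\frac27z_1z_2^3,0)$; $x_1x_3^3\mapsto(z_1^2z_2^6,-\frac3{14}z_2^4,0)$; $x_2^4\mapsto(16z_1^4z_2^4,\frac{24}7z_1^2z_2^2,\frac15)$; $x_2^3x_3\mapsto(8z_1^3z_2^5,\frac67z_1z_2^3,0)$; $x_2^2x_3^2\mapsto(4z_1^2z_2^6,\frac17z_2^4,0)$; $x_2x_3^3\mapsto(2z_1z_2^7,0,0)$; $x_3^4\mapsto(z_2^8,0,0)$. A joint invariant is an $\mathrm{SL}(W)$-invariant polynomial function on $\mathrm{Sym}^8(W^* )\oplus\mathrm{Sym}^4(W^* )\oplus\mathrm{Sym}^0(W^* )$, homogeneous in the coefficients of each component (the projection to $\mathrm{Sym}^0(W^* )=K$ is one of them). *)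

(* Defs.v *)
From HB Require Import structures.
From mathcomp Require Import all_boot all_order all_algebra.
From mathcomp Require Import mpoly.

Set Implicit Arguments.
Unset Strict Implicit.
Unset Printing Implicit Defensive.

Import GRing.Theory.
Local Open Scope ring_scope.

(* Forms are homogeneous elements of {mpoly K[n]}.  For n = 3 the variables
   'X_0, 'X_1, 'X_2 are x_1, x_2, x_3 in a form on V and v_1, v_2, v_3 in a
   contravariant; for n = 2 they are z_1, z_2. *)

(* f.T : substitute \sum_j T i j *: 'X_j for 'X_i, that is, f.T = f \o T as a
   function of column vectors. *)
Definition lsubst (K : fieldType) (n : nat) (f : {mpoly K[n]}) (T : 'M[K]_n) :
  {mpoly K[n]} :=
  f \mPo [tuple \sum_(j < n) T i j *: 'X_j | i < n].

Definition SLequiv (K : fieldType) (n : nat) (f g : {mpoly K[n]}) : Prop :=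
  exists2 T : 'M[K]_n, \det T = 1 & g = lsubst f T.

Definition monom (n d : nat) := {m : 'X_{1..n < d.+1} | mdeg m == d}.

(* The coefficients of f at all monomials of degree d: linear coordinates on the
   space of forms of degree d. *)
Definition coords (K : fieldType) (n d : nat) (f : {mpoly K[n]})
  (i : 'I_#|{: monom n d}|) : K :=
  f@_(val (val (enum_val i))).

Definition zariski_closed (K : fieldType) (n d : nat)
  (A : {mpoly K[n]} -> Prop) : Prop :=
  exists I : {mpoly K[#|{: monom n d}|]} -> Prop,
    forall f : {mpoly K[n]}, f \is d.-homog ->
      (A f <-> forall p, I p -> p.@[coords (d := d) f] = 0).

(* Finiteness of the stabilizer in SL_3 is membership in a finite list. *)
Definition stable (K : fieldType) (F : {mpoly K[3]}) : Prop :=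
  zariski_closed 4 (SLequiv F) /\
  exists s : seq 'M[K]_3,
    forall T : 'M[K]_3, \det T = 1 -> lsubst F T = F -> T \in s.

(* For a quartic F this is v_3^4 F(s, t, - (v_1 s + v_2 t) / v_3), as a form in
   s = 'X_0, t = 'X_1 with coefficients in K[v_1, v_2, v_3]: by homogeneity the
   factor v_3^4 can be moved into the arguments of F. *)
Definition line_form (K : fieldType) (F : {mpoly K[3]}) :
  {mpoly {mpoly K[3]}[2]} :=
  let v (i : 'I_3) : {mpoly {mpoly K[3]}[2]} := ('X_i)%:MP in
  let s : {mpoly {mpoly K[3]}[2]} := 'X_0 in
  let t : {mpoly {mpoly K[3]}[2]} := 'X_1 in
  mmap (fun c : K => (c%:MP)%:MP)
       (tnth [tuple v 2 * s; v 2 * t; - (v 0 * s + v 1 * t)]) F.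

Definition line_coef (K : fieldType) (F : {mpoly K[3]}) (k : nat) :
  {mpoly K[3]} :=
  ('C(4, k)%:R : K)^-1 *: (line_form F)@_[multinom [tuple (4 - k)%N; k]].

Definition salmon_num (K : fieldType) (F : {mpoly K[3]}) : {mpoly K[3]} :=
  let q := line_coef F in
  q 0 * q 2 * q 4 + 2 * q 1 * q 2 * q 3 - q 0 * q 3 ^+ 2
    - q 1 ^+ 2 * q 4 - q 2 ^+ 3.

(* The quotient of p by v_3^6, terms not divisible by v_3^6 being dropped.  When
   F is a quartic, salmon_num F has no such terms. *)
Definition div_v3_6 (K : fieldType) (p : {mpoly K[3]}) : {mpoly K[3]} :=
  \sum_(m <- msupp p | (6 <= m 2%R)%N) p@_m *: 'X_[m - U_(2%R) *+ 6].

Definition psi (K : fieldType) (F : {mpoly K[3]}) : {mpoly K[3]} :=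
  div_v3_6 (salmon_num F).

Definition rho (K : fieldType) (F : {mpoly K[3]}) : {mpoly K[3]} :=
  (144 : K)^-1 *: \sum_(m <- msupp F) F@_m *: (psi F)^`M[m].

(* rho F is a quadratic form, so its second derivatives are constants; they are
   read off as elements of K by taking the constant coefficient. *)
Definition I12 (K : fieldType) (F : {mpoly K[3]}) : K :=
  \det (\matrix_(i < 3, j < 3)
          ((2 : K)^-1 *: (rho F)^`M(i)^`M(j))@_(0%MM : 'X_{1..3})).

Definition inZ (K : fieldType) (F : {mpoly K[3]}) : Prop :=
  F \is 4.-homog /\
  exists2 u : K, u != 0 & rho F = u *: ('X_1 ^+ 2 - 'X_0 * 'X_2).

Definition triple (K : fieldType) : lmodType K :=
  ({mpoly K[2]} * {mpoly K[2]} * K^o)%type.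

Definition is_form_triple (K : fieldType) (b : triple K) : Prop :=
  b.1.1 \is 8.-homog /\ b.1.2 \is 4.-homog.

Definition tsubst (K : fieldType) (b : triple K) (T : 'M[K]_2) : triple K :=
  (lsubst b.1.1 T, lsubst b.1.2 T, b.2).

Definition lstar (K : fieldType) (F : {mpoly K[3]}) : triple K :=
  let c (i j k : nat) : K := F@_[multinom [tuple i; j; k]] in
  let z1 : {mpoly K[2]} := 'X_0 in
  let z2 : {mpoly K[2]} := 'X_1 in
  let r (a b : nat) : K := a%:R / b%:R in
  let b (b8 b4 : {mpoly K[2]}) (b0 : K) : triple K := (b8, b4, b0) in
    c 4 0 0 *: b (z1 ^+ 8) 0 0
  + c 3 1 0 *: b (2 * z1 ^+ 7 * z2) 0 0
  + c 3 0 1 *: b (z1 ^+ 6 * z2 ^+ 2) (- r 3 14 *: z1 ^+ 4) 0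
  + c 2 2 0 *: b (4 * z1 ^+ 6 * z2 ^+ 2) (r 1 7 *: z1 ^+ 4) 0
  + c 2 1 1 *: b (2 * z1 ^+ 5 * z2 ^+ 3) (- r 2 7 *: (z1 ^+ 3 * z2)) 0
  + c 2 0 2 *: b (z1 ^+ 4 * z2 ^+ 4) (- r 2 7 *: (z1 ^+ 2 * z2 ^+ 2)) (r 1 30)
  + c 1 3 0 *: b (8 * z1 ^+ 5 * z2 ^+ 3) (r 6 7 *: (z1 ^+ 3 * z2)) 0
  + c 1 2 1 *: b (4 * z1 ^+ 4 * z2 ^+ 4) (- r 1 7 *: (z1 ^+ 2 * z2 ^+ 2)) (- r 1 30)
  + c 1 1 2 *: b (2 * z1 ^+ 3 * z2 ^+ 5) (- r 2 7 *: (z1 * z2 ^+ 3)) 0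
  + c 1 0 3 *: b (z1 ^+ 2 * z2 ^+ 6) (- r 3 14 *: z2 ^+ 4) 0
  + c 0 4 0 *: b (16 * z1 ^+ 4 * z2 ^+ 4) (r 24 7 *: (z1 ^+ 2 * z2 ^+ 2)) (r 1 5)
  + c 0 3 1 *: b (8 * z1 ^+ 3 * z2 ^+ 5) (r 6 7 *: (z1 * z2 ^+ 3)) 0
  + c 0 2 2 *: b (4 * z1 ^+ 2 * z2 ^+ 6) (r 1 7 *: z2 ^+ 4) 0
  + c 0 1 3 *: b (2 * z1 * z2 ^+ 7) 0 0
  + c 0 0 4 *: b (z2 ^+ 8) 0 0.

Notation n8 := #|{: monom 2 8}|.
Notation n4 := #|{: monom 2 4}|.

Definition tcoords (K : fieldType) (b : triple K) (i : 'I_(n8 + n4 + 1)) : K :=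
  match split i with
  | inl i' => match split i' with
              | inl k => coords (d := 8) b.1.1 k
              | inr k => coords (d := 4) b.1.2 k
              end
  | inr _ => b.2
  end.

Definition multihomog (K : fieldType) (p : {mpoly K[n8 + n4 + 1]}) : Prop :=
  exists d8 d4 d0 : nat, forall m, m \in msupp p ->
    [/\ (\sum_(k < n8) m (lshift 1 (lshift n4 k)))%N = d8,
        (\sum_(k < n4) m (lshift 1 (rshift n8 k)))%N = d4
      & m (rshift (n8 + n4) ord0) = d0].

Definition joint_invariant (K : fieldType) (p : {mpoly K[n8 + n4 + 1]}) : Prop :=
  multihomog p /\
  forall (b : triple K) (T : 'M[K]_2), is_form_triple b -> \det T = 1 ->
    p.@[tcoords (tsubst b T)] = p.@[tcoords b].

(* Main.v *)
(* The triple b = lstar F' is stable for SL_2: no linear form divides b_8 four times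
   and b_4 twice.  Indeed b_8 and b_4 are the pullbacks of F' and of a second-order
   derivative of F' to a conic, on which SL_2 acts through its symmetric square.  If b
   were not stable, a torus of SL_3 would contract some form in the orbit of F to a
   form fixed by the torus; as the orbit of F is closed, F itself would have an
   infinite stabilizer.

   For a stable triple the orbit map from SL_2 is finite, so the orbit is closed.
   Averaging polynomials with the invariant integral on SL_2 turns equality of joint
   invariants into equality of orbit integrals.  Suppose b' is stable too, and let f
   vanish on the orbit of b.  Then f lies in the ideal N of the functions f with
   vanishing integrals of f g over the orbit of b', for all g, and so do the
   translates of f.  If f(b') were not zero, these translates would generate the unit
   ideal on SL_2, and Nakayama's lemma would give an h in N with h = 1 on the orbit
   of b', in contradiction to the integral of h being zero.  So b' lies in the closed
   orbit of b.  Finally b' is stable: otherwise it would degenerate to a triple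
   (c Q^4, d Q^2, e), and b would lie in the closure of the orbit of that triple,
   which contains only triples of the same unstable shape. *)
From HB Require Import structures.
Require Import Defs.
From mathcomp Require Import all_boot all_order all_algebra.
From mathcomp Require Import ssrcomplements mpoly.
From mathcomp Require Import ring zify.
From Stdlib Require Import Classical.

Set Implicit Arguments.
Unset Strict Implicit.
Unset Printing Implicit Defensive.

Import GRing.Theory.
Local Open Scope ring_scope.

(** [K] is an abstract algebraically closed field, so there is neither a compact group nor a
    topology. The integral is therefore a formula on monomials in the matrix entries, its invariance
    is checked on generators of SL_2, and a limit is the value at 0 of a polynomial in [t] that is
    constant elsewhere. The integral has no positivity to exploit, which is why Nakayama's lemma
    enters. Finiteness is phrased through values of polynomials on a set [X], without quotient
    rings. For a stable triple it comes from an explicit relation: the first matrix entry [a]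
    satisfies an equation writing [a ^ (Q + 1)] in degree at most [Q] over the coordinates of the
    orbit point. The relation is a Bezout identity among the coordinates whose common vanishing
    would make the triple unstable, and translations carry it to the other entries. Finiteness then
    serves three times: in Nakayama's lemma, for the closedness of stable orbits, and for the
    closedness of the set of triples of powers of a quadric. *)

(** * Polynomials over an algebraically closed field as functions *)

Section PolynomialFunctions.
Variable K : closedFieldType.

Lemma poly_eq0_horner (p : {poly K}) : (forall x, p.[x] = 0) -> p = 0.
Proof.
move=> p0; apply/eqP/negPn/negP=> /closed_nonrootP [x /negP]; apply.
by rewrite /root p0.
Qed.

(** The polynomial [(p - c) * 'X] vanishes everywhere. Every limit under a torus reduces to this
    fact. *)
Lemma horner_punctured (p : {poly K}) c :
  (forall t, t != 0 -> p.[t] = c) -> p.[0] = c.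
Proof.
move=> pc; have /eqP: (p - c%:P) * 'X = 0.
  apply: poly_eq0_horner => x; have [->|/pc px] := eqVneq x 0.
    by rewrite hornerM hornerX mulr0.
  by rewrite !hornerE px subrr mul0r.
by rewrite mulf_eq0 polyX_eq0 orbF subr_eq0 => /eqP->; rewrite hornerC.
Qed.

Lemma muni_meval n (p : {mpoly K[n.+1]}) (v : 'I_n.+1 -> K) :
  p.@[v] =
  (map_poly (meval (fun i => v (widen_ord (leqnSn n) i))) (muni p)).[v ord_max].
Proof.
rewrite mevalE muniE rmorph_sum horner_sum; apply: eq_bigr => m _ /=.
rewrite map_polyZ hornerZ /= mevalZ mevalX map_polyXn hornerXn -mulrA.
rewrite big_ord_recr /=; congr (_ * (_ * _)).
by apply: eq_bigr => i _; rewrite mnmE.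
Qed.

(** All coefficients of [p] are found in [muni p], so [p] vanishes once [muni p] does; this drives
    the induction on the number of variables. *)
Lemma muni_coef n (p : {mpoly K[n.+1]}) (m : 'X_{1..n.+1}) :
  p@_m = ((muni p)`_(m ord_max))@_[multinom m (widen_ord (leqnSn n) i) | i < n].
Proof.
rewrite muniE coef_sum raddf_sum /= {1}[p]mpolyE raddf_sum /=.
apply: eq_bigr => k _; rewrite !coefZ coefXn !mulr_natr mulrb.
rewrite mcoeffZ mcoeffX; case: (eqVneq k m) => [->|ne].
  by rewrite eqxx mcoeffZ mcoeffX eqxx.
rewrite /= mulr0; case: eqP => [e|_]; last by rewrite mcoeff0.
rewrite mcoeffZ mcoeffX; case: eqP => [/mnmP e2|_]; last by rewrite mulr0.
case/eqP: ne; apply/mnmP=> i; case: (unliftP ord_max i) => [j ->|->]; last by rewrite e.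
have := e2 j; rewrite !mnmE.
suff -> : widen_ord (leqnSn n) j = lift ord_max j by [].
by apply: val_inj; rewrite /= /bump leqNgt ltn_ord.
Qed.

Lemma mpoly_eq0_meval n (p : {mpoly K[n]}) : (forall v, p.@[v] = 0) -> p = 0.
Proof.
elim: n p => [|n IH] p p0.
  by move: (p0 (fun=> 0)); rewrite (nvar0_mpolyC p) mevalC => ->.
suff u0: muni p = 0 by apply/mpolyP=> m; rewrite muni_coef u0 coef0 !mcoeff0.
apply/polyP=> k; rewrite coef0; apply: IH => v; rewrite -coef_map /=.
suff -> : map_poly (meval v) (muni p) = 0 by rewrite coef0.
apply: poly_eq0_horner => t.
pose w (i : 'I_n.+1) := if unlift ord_max i is Some j then v j else t.
have := p0 w; rewrite muni_meval => <-; rewrite {2}/w unlift_none.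
congr (horner _ _); apply/polyP => j; rewrite !coef_map /=.
apply: meval_eq => i; rewrite /w.
have -> : widen_ord (leqnSn n) i = lift ord_max i.
  by apply: val_inj; rewrite /= /bump leqNgt ltn_ord.
by rewrite liftK.
Qed.

Lemma meval_poly n (p : {mpoly K[n]}) (x : 'I_n -> {poly K}) :
  exists q : {poly K}, forall t, q.[t] = p.@[fun i => (x i).[t]].
Proof.
exists (mmap polyC x p) => t; rewrite /mmap horner_sum mevalE.
apply: eq_bigr => m _; rewrite hornerM hornerC horner_prod.
by congr (_ * _); apply: eq_bigr => i _; rewrite horner_exp.
Qed.

Lemma meval_mmap n N (h : {mpoly K[N]}) (phi : 'I_N -> {mpoly K[n]}) x :
  (h \mPo [tuple phi i | i < N]).@[x] = h.@[fun i => (phi i).@[x]].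
Proof. by rewrite comp_mpoly_meval; apply: meval_eq => i; rewrite tnth_mktuple. Qed.

End PolynomialFunctions.

(** * Ideals and the Nullstellensatz for zero-dimensional ideals *)

Record ideal_pred (R : comNzRingType) (J : R -> Prop) : Prop := IdealPred {
  ideal0 : J 0;
  idealD : forall f g, J f -> J g -> J (f + g);
  idealM : forall f g, J f -> J (g * f) }.

Section Ideals.
Variables (R : comNzRingType) (J : R -> Prop).
Hypothesis JI : ideal_pred J.

Lemma ideal_sum (I : Type) (r : seq I) (P : pred I) F :
  (forall i, P i -> J (F i)) -> J (\sum_(i <- r | P i) F i).
Proof. by move=> JF; apply: big_ind => //; [exact: ideal0 | exact: idealD]. Qed.

Lemma ideal_congM a b c d : J (a - b) -> J (c - d) -> J (a * c - b * d).
Proof.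
move=> Jab Jcd; have -> : a * c - b * d = c * (a - b) + b * (c - d) by ring.
by apply: idealD => //; apply: idealM.
Qed.

Lemma ideal_cong_prod (I : Type) (r : seq I) (P : pred I) (F G : I -> R) :
  (forall i, P i -> J (F i - G i)) ->
  J (\prod_(i <- r | P i) F i - \prod_(i <- r | P i) G i).
Proof.
move=> JFG; apply: (big_ind2 (fun a b => J (a - b))) => //; last exact: ideal_congM.
by rewrite subrr; apply: ideal0.
Qed.

Lemma ideal_det k (A B : 'M_k) :
  (forall i j, J (A i j - B i j)) -> J (\det A - \det B).
Proof.
move=> JAB; rewrite -sumrB; apply: ideal_sum => s _.
by rewrite -mulrBr; apply: idealM => //; apply: ideal_cong_prod.
Qed.

End Ideals.

Section ZeroDimensional.
Variables (K : closedFieldType) (n : nat).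
Implicit Types (J : {mpoly K[n]} -> Prop) (r : seq K).

(** If adjoining ['X_i - c] gives the unit ideal, multiplying the relation for 1 by the remaining
    factors puts the shorter product into [J]. This cannot go on down to the empty product, which is
    1. *)
Lemma ideal_add_linear J (i : 'I_n) r :
  ideal_pred J -> ~ J 1 -> J (\prod_(c <- r) ('X_i - c%:MP)) ->
  exists (J' : {mpoly K[n]} -> Prop) (c : K),
    [/\ ideal_pred J', ~ J' 1, forall p, J p -> J' p & J' ('X_i - c%:MP)].
Proof.
move=> JI J1; elim: r => [|c r IH]; first by rewrite big_nil.
rewrite big_cons => Jr.
pose J' p := exists g h, J g /\ p = g + h * ('X_i - c%:MP).
have J'I : ideal_pred J'.
  split; first by exists 0, 0; rewrite mul0r addr0; split=> //; apply: ideal0.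
    move=> _ _ [g1 [h1 [Jg1 ->]]] [g2 [h2 [Jg2 ->]]]; exists (g1 + g2), (h1 + h2).
    by split; [apply: idealD | ring].
  move=> _ f [g [h [Jg ->]]]; exists (f * g), (f * h).
  by split; [apply: idealM | ring].
case: (classic (J' 1)) => [[g [h [Jg e]]]|J'1].
  apply: IH; set q := \prod_(_ <- _) _.
  have -> : q = q * g + h * (('X_i - c%:MP) * q).
    by rewrite -[LHS]mulr1 e /q; ring.
  by apply: idealD => //; apply: idealM.
exists J', c; split=> // [p Jp|]; first by exists p, 0; rewrite mul0r addr0.
by exists 0, 1; rewrite add0r mul1r; split=> //; apply: ideal0.
Qed.

(** Each [chi] splits into linear factors, so one factor per variable can be adjoined while the
    ideal stays proper; the chosen roots form the common zero. *)
Lemma zero_dim_nullstellensatz J :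
  ideal_pred J -> ~ J 1 ->
  (forall i, exists2 chi : {poly K}, chi != 0 & J (map_poly (@mpolyC n K) chi).['X_i]) ->
  exists x, forall p, J p -> p.@[x] = 0.
Proof.
move=> JI J1 Jchi.
have [J' [x [J'I J'1 JJ' J'x]]] : exists (J' : {mpoly K[n]} -> Prop) (x : 'I_n -> K),
    [/\ ideal_pred J', ~ J' 1, forall p, J p -> J' p &
        forall i, i \in enum 'I_n -> J' ('X_i - (x i)%:MP)].
  elim: (enum 'I_n) => [|i r [J' [x [J'I J'1 JJ' J'x]]]]; first by exists J, (fun=> 0).
  have [chi chi0 /JJ' Jc] := Jchi i.
  have [r' e] := closed_field_poly_normal chi.
  have [] := @ideal_add_linear J' i r' => //.
    move: Jc; rewrite e map_polyZ /= hornerZ rmorph_prod horner_prod /= => Jc.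
    have := idealM J'I ((lead_coef chi)^-1%:MP) Jc.
    rewrite mulrA -mpolyCM mulVf ?lead_coef_eq0 // mul1r.
    by under eq_bigr do rewrite rmorphB /= map_polyX map_polyC /= hornerXsubC.
  move=> J'' [c [J''I J''1 J'J'' J''c]].
  exists J'', (fun j => if j == i then c else x j); split=> // [p /JJ'/J'J''//|j].
  rewrite inE; case: eqVneq => [->//|_ /=] /J'x; exact: J'J''.
(* Modulo [J'] every polynomial is congruent to its value at [x], so a non-zero value of [p] would
   put a unit into [J']. *)
exists x => p /JJ' Jp; apply/eqP/negPn/negP => px; apply: J'1.
have : J' (p - (p.@[x])%:MP).
  rewrite {1}[p]mpolyE mevalE rmorph_sum /= -sumrB; apply: ideal_sum => // m _.
  rewrite -mul_mpolyC mpolyCM -mulrBr; apply: idealM => //.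
  rewrite mpolyXE_id rmorph_prod /=; apply: ideal_cong_prod => // i _.
  rewrite rmorphXn /=; elim: (m i) => [|k IH]; first by rewrite subrr; apply: ideal0.
  by rewrite !exprS; apply: ideal_congM => //; apply: J'x; rewrite mem_enum.
move/(idealM J'I (-1)); rewrite mulN1r opprB => /(idealD J'I Jp).
rewrite addrC subrK => /(idealM J'I ((p.@[x])^-1%:MP)).
by rewrite -mpolyCM mulVf.
Qed.

End ZeroDimensional.

(** * Finite polynomial maps *)
Section FiniteMaps.
Variables (K : closedFieldType) (n N : nat).
Variables (X : ('I_n -> K) -> Prop) (phi : 'I_N -> {mpoly K[n]}).

Let ev (x : 'I_n -> K) : 'I_N -> K := fun i => (phi i).@[x].

(** The functions on [X] form a module over the polynomials in [phi]; this is its submodule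
    generated by the monomials of degree at most [D]. Coefficients do not count towards the
    degree. *)
Definition in_span (D : nat) (g : ('I_n -> K) -> K) : Prop :=
  exists2 s : seq ({mpoly K[N]} * 'X_{1..n}),
    all (fun u => mdeg u.2 <= D)%N s &
    forall x, X x -> g x = \sum_(u <- s) u.1.@[ev x] * 'X_[u.2].@[x].

Lemma in_span_ext D g1 g2 :
  (forall x, X x -> g1 x = g2 x) -> in_span D g1 -> in_span D g2.
Proof. by move=> e [s sD sg]; exists s => // x Xx; rewrite -e // sg. Qed.

Lemma in_span_le D E g : (D <= E)%N -> in_span D g -> in_span E g.
Proof.
by move=> DE [s sD sg]; exists s => //; apply: sub_all sD => u /leq_trans; apply.
Qed.

Lemma in_spanA h : in_span 0 (fun x => h.@[ev x]).
Proof.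
exists [:: (h, 0%MM)] => [|x _]; first by rewrite /= mdeg0.
by rewrite big_seq1 mpolyX0 meval1 mulr1.
Qed.

Lemma in_spanX m : in_span (mdeg m) (fun x => 'X_[m].@[x]).
Proof.
exists [:: (1, m)] => [|x _]; first by rewrite /= leqnn.
by rewrite big_seq1 meval1 mul1r.
Qed.

Lemma in_spanD D g1 g2 : in_span D g1 -> in_span D g2 ->
  in_span D (fun x => g1 x + g2 x).
Proof.
move=> [s1 s1D s1g] [s2 s2D s2g]; exists (s1 ++ s2); first by rewrite all_cat s1D.
by move=> x Xx; rewrite big_cat s1g // s2g.
Qed.

Lemma in_spanM D E g1 g2 : in_span D g1 -> in_span E g2 ->
  in_span (D + E) (fun x => g1 x * g2 x).
Proof.
move=> [s1 s1D s1g] [s2 s2D s2g].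
exists [seq (u.1 * v.1, (u.2 + v.2)%MM) | u <- s1, v <- s2].
  apply/allP=> w /allpairsP [[u v] /= [us vs ->]] /=.
  by rewrite mdegD leq_add // ?(allP s1D) ?(allP s2D).
move=> x Xx; rewrite s1g // s2g // big_allpairs_dep big_distrlr /=.
apply: eq_bigr => u _; apply: eq_bigr => v _.
by rewrite mevalM mpolyXD mevalM mulrACA.
Qed.

Lemma in_span_sum D (I : Type) (r : seq I) (P : pred I) (F : I -> ('I_n -> K) -> K) :
  (forall i, P i -> in_span D (F i)) -> in_span D (fun x => \sum_(i <- r | P i) F i x).
Proof.
move=> FD; elim: r => [|i r IH].
  by exists [::] => // x _; rewrite !big_nil.
case Pi: (P i); last by apply: in_span_ext IH => x _; rewrite big_cons Pi.
by apply: in_span_ext (in_spanD (FD i Pi) IH) => x _; rewrite big_cons Pi.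
Qed.

Lemma in_span0 D : in_span D (fun=> 0).
Proof. by exists [::] => // x _; rewrite big_nil. Qed.

Lemma in_spanZ D c g : in_span D g -> in_span D (fun x => c * g x).
Proof.
by move/(in_spanM (in_spanA c%:MP)); apply: in_span_ext => x _; rewrite mevalC.
Qed.

Definition finite_map := exists D, forall p : {mpoly K[n]}, in_span D (fun x => p.@[x]).

(** The hypothesis lowers the degree by at least one, which is stronger than integrality. A monomial
    of degree above [n * k] has an exponent above [k] by the pigeonhole principle, so the rewriting
    ends in degree at most [n * k]. *)
Lemma finite_map_criterion :
  (exists k, forall i : 'I_n, in_span k (fun x => x i ^+ k.+1)) -> finite_map.
Proof.
case=> k xk; exists (n * k)%N.
have mono d : forall m : 'X_{1..n}, (mdeg m <= d)%N ->
    in_span (n * k) (fun x => 'X_[m].@[x]).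
  elim/ltn_ind: d => d IHd m md.
  have [mnk|mnk] := leqP (mdeg m) (n * k); first exact: in_span_le (in_spanX m).
  have [i mi] : exists i, (k < m i)%N.
    apply/existsP; apply: contraLR mnk; rewrite negb_exists -leqNgt => /forallP mk.
    rewrite mdegE; apply: leq_trans (_ : \sum_(i < n) k <= _)%N.
      by apply: leq_sum => i _; rewrite leqNgt.
    by rewrite sum_nat_const card_ord.
  pose m' := (m - U_(i) *+ k.+1)%MM.
  have em : m = (m' + U_(i) *+ k.+1)%MM.
    apply/mnmP=> j; rewrite mnmDE mnmBE mulmnE mnm1E; case: eqP => [<-|_].
      by rewrite mul1n subnK.
    by rewrite mul0n subn0 addn0.
  have dm : mdeg m = (mdeg m' + k.+1)%N by rewrite {1}em mdegD mdegMn mdeg1 mul1n.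
  have [s sD sg] := in_spanM (in_spanX m') (xk i).
  have dlt u : u \in s -> (mdeg u.2 < d)%N.
    move=> us; apply: leq_ltn_trans (allP sD _ us) _.
    by apply: leq_trans md; rewrite dm ltn_add2l.
  have {}IHd u : u \in s -> in_span (n * k) (fun x => 'X_[u.2].@[x]).
    by move=> us; apply: (IHd (mdeg u.2)) => //; apply: dlt.
  apply: (@in_span_ext _ (fun x => \sum_(u <- s) u.1.@[ev x] * 'X_[u.2].@[x])).
    move=> x Xx; rewrite -sg // em mpolyXD mevalM; congr (_ * _).
    rewrite mevalX (bigD1 i) //= mulmnE mnm1E eqxx mul1n big1 ?mulr1 //.
    by move=> j ji; rewrite mulmnE mnm1E eq_sym (negbTE ji) mul0n expr0.
  have : {subset s <= s} by [].
  elim: {-2}s => [|u r IH] sr; first by exists [::] => // x _; rewrite !big_nil.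
  have us : u \in s by apply: sr; rewrite inE eqxx.
  have rs : {subset r <= s} by move=> w wr; apply: sr; rewrite inE wr orbT.
  apply: in_span_ext (in_spanD (in_spanM (in_spanA u.1) (IHd u us)) (IH rs)).
  by move=> x _; rewrite big_cons.
move=> p; apply: (@in_span_ext _ (fun x => \sum_(m <- msupp p) p@_m * 'X_[m].@[x])).
  by move=> x _; rewrite mevalE; apply: eq_bigr => m _; rewrite mevalX.
by apply: in_span_sum => m _; apply/in_spanZ/(mono (mdeg m)).
Qed.

(** Collecting equal monomials replaces the list by a fixed finite index type, as the matrix
    arguments below require. *)
Lemma in_span_bmnm D g : in_span D g ->
  exists c : 'X_{1..n < D.+1} -> {mpoly K[N]},
    forall x, X x -> g x = \sum_m (c m).@[ev x] * 'X_[bmnm m].@[x].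
Proof.
move=> [s sD sg].
exists (fun m => \sum_(u <- s | u.2 == m :> 'X_{1..n}) u.1) => x Xx.
rewrite sg // {sg}; under [RHS]eq_bigr do rewrite raddf_sum mulr_suml.
rewrite (exchange_big_dep predT) //= [LHS]big_seq [RHS]big_seq.
apply: eq_bigr => u us; have um : (mdeg u.2 < D.+1)%N by rewrite ltnS (allP sD).
rewrite (big_pred1 (BMultinom um)) //.
Qed.

(** The extension of [J] along [phi]. It contains every polynomial vanishing on [X], through the
    empty list. *)
Definition ideal_span (J : {mpoly K[N]} -> Prop) (p : {mpoly K[n]}) : Prop :=
  exists2 s : seq ({mpoly K[N]} * {mpoly K[n]}),
    (forall u, u \in s -> J u.1) &
    forall x, X x -> p.@[x] = \sum_(u <- s) u.1.@[ev x] * u.2.@[x].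

Lemma ideal_span_ideal J : ideal_pred (ideal_span J).
Proof.
split; first by exists [::] => // x _; rewrite big_nil meval0.
  move=> f g [s1 s1D s1g] [s2 s2D s2g]; exists (s1 ++ s2).
    by move=> u; rewrite mem_cat => /orP[/s1D|/s2D].
  by move=> x Xx; rewrite big_cat mevalD s1g // s2g.
move=> f g [s sD sg]; exists [seq (u.1, g * u.2) | u <- s].
  by move=> u /mapP [v /sD vD ->].
move=> x Xx; rewrite big_map mevalM sg // mulr_sumr; apply: eq_bigr => u _.
by rewrite mevalM mulrCA.
Qed.

Lemma ideal_span_gen (J : {mpoly K[N]} -> Prop) h :
  J h -> ideal_span J (h \mPo [tuple phi i | i < N]).
Proof.
move=> Jh; exists [:: (h, 1)] => [u|x _]; first by rewrite inE => /eqP->.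
by rewrite big_seq1 meval1 mulr1 meval_mmap.
Qed.

Hypothesis phi_finite : finite_map.

(* Nakayama: multiplying [1 = \sum u.1 u.2] by each of the module generators
   gives a square system [m = H m] with entries of [H] in [J]; then [det (1 - H)]
   vanishes on [X] and is congruent to [1] modulo [J]. *)
Lemma finite_map_nakayama (J : {mpoly K[N]} -> Prop) :
  ideal_pred J -> ideal_span J 1 ->
  exists2 h, J h & forall x, X x -> h.@[ev x] = 1.
Proof.
move=> JI [s sJ s1]; have [D fD] := phi_finite.
pose I := 'X_{1..n < D.+1}.
have span p : ideal_span J p -> exists c : I -> {mpoly K[N]},
    (forall m, J (c m)) /\
    forall x, X x -> p.@[x] = \sum_m (c m).@[ev x] * 'X_[bmnm m].@[x].
  case=> {s1}s {}sJ sp; suff [c [cJ cP]] : exists c : I -> {mpoly K[N]},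
      (forall m, J (c m)) /\ forall x, X x -> \sum_(u <- s) u.1.@[ev x] * u.2.@[x]
        = \sum_m (c m).@[ev x] * 'X_[bmnm m].@[x].
    by exists c; split=> // x Xx; rewrite sp // cP.
  elim: s sJ {sp} => [|u s IH] sJ.
    exists (fun=> 0); split=> [_|x _]; first exact: ideal0.
    by rewrite big_nil big1 // => m _; rewrite meval0 mul0r.
  case: IH => [v vs|c [cJ cP]]; first by apply: sJ; rewrite inE vs orbT.
  have [d dP] := in_span_bmnm (fD u.2).
  exists (fun m => d m * u.1 + c m); split=> [m|x Xx].
    by apply: idealD => //; apply: idealM => //; apply: sJ; rewrite inE eqxx.
  rewrite big_cons cP // dP // mulr_sumr -big_split /=; apply: eq_bigr => m _.
  by rewrite mevalD mevalM mulrDl mulrCA mulrA.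
have /fin_all_exists [H HP] : forall l : I, exists c : I -> {mpoly K[N]},
    (forall m, J (c m)) /\ forall x, X x ->
      'X_[bmnm l].@[x] = \sum_m (c m).@[ev x] * 'X_[bmnm m].@[x].
  move=> l; apply: span; rewrite -[X in ideal_span _ X]mulr1.
  by apply: idealM; [exact: ideal_span_ideal | exists s].
have HJ l m : J (H l m) by have [HJ _] := HP l.
have Hx x l : X x -> 'X_[bmnm l].@[x] = \sum_m (H l m).@[ev x] * 'X_[bmnm m].@[x].
  by have [_] := HP l; apply.
pose M : 'M[{mpoly K[N]}]_#|{: I}| := \matrix_(i, j) H (enum_val i) (enum_val j).
have detJ : J (1 - \det (1%:M - M)).
  rewrite -[X in X - _](@det1 _ #|{: I}|); apply: ideal_det => // i j; rewrite !mxE.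
  by rewrite opprB addrCA subrr addr0.
exists (1 - \det (1%:M - M)) => // x Xx.
rewrite mevalB meval1 -[RHS]subr0; congr (_ - _).
rewrite -det_map_mx map_mxB map_mx1.
rewrite -det_tr; apply/eqP/det0P.
exists (\row_i 'X_[bmnm (enum_val i)].@[x]).
  apply/eqP => /rowP /(_ (enum_rank (@bm0 n D))).
  by rewrite !mxE enum_rankK mpolyX0 meval1 => /eqP; rewrite oner_eq0.
apply/rowP => j; rewrite [RHS]mxE linearB /= trmx1 mulmxBr mulmx1 !mxE Hx //.
apply/eqP; rewrite subr_eq0; apply/eqP.
rewrite (reindex_onto enum_val enum_rank) /=; last by move=> i _; rewrite enum_rankK.
apply: eq_big => [i|i _]; first by rewrite enum_valK eqxx.
by rewrite !mxE mulrC.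
Qed.

(** Lying over: the maximal ideal of [y] extends to a proper ideal by Nakayama's lemma, and a zero
    of the extension is the point sought. It lies in the closure of [X] because the extension
    contains whatever vanishes on [X]. *)
Lemma finite_map_lift (y : 'I_N -> K) :
  (forall h : {mpoly K[N]}, (forall x, X x -> h.@[ev x] = 0) -> h.@[y] = 0) ->
  exists2 x : 'I_n -> K, (forall i, (phi i).@[x] = y i) &
    forall p : {mpoly K[n]}, (forall z, X z -> p.@[z] = 0) -> p.@[x] = 0.
Proof.
move=> y_cl; pose m_y (h : {mpoly K[N]}) := h.@[y] = 0.
have myI : ideal_pred m_y.
  split; rewrite /m_y; first exact: meval0.
    by move=> f g; rewrite mevalD => -> ->; rewrite addr0.
  by move=> f g; rewrite mevalM => ->; rewrite mulr0.
have [] := @zero_dim_nullstellensatz K n (ideal_span m_y).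
- exact: ideal_span_ideal.
- case/(finite_map_nakayama myI) => h hy h1.
  have := y_cl (h - 1); rewrite mevalB meval1 hy sub0r => /(_ _)/eqP.
  rewrite oppr_eq0 oner_eq0 => /(_ _)/negP[] // x Xx.
  by rewrite mevalB meval1 h1 // subrr.
- move=> i; have [D fD] := phi_finite; pose I := 'X_{1..n < D.+1}.
  have /fin_all_exists [c cP] : forall j : 'I_#|{: I}|.+1,
      exists c : I -> {mpoly K[N]}, forall x, X x ->
        ('X_i ^+ j).@[x] = \sum_m (c m).@[ev x] * 'X_[bmnm m].@[x].
    by move=> j; apply/in_span_bmnm/fD.
  (* There is one more power of ['X_i] than there are module generators, so over [y] the rows are
     dependent; a relation between them supplies [chi]. *)
  pose A : 'M[K]_(#|{: I}|.+1, #|{: I}|) := \matrix_(j, k) (c j (enum_val k)).@[y].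
  have : kermx A != 0.
    rewrite kermx_eq0 /row_free neq_ltn; apply/orP; left.
    by rewrite ltnS rank_leq_col.
  case/rowV0Pn => v /sub_kermxP vA v0; exists (\poly_(j < #|{: I}|.+1) v ord0 (inord j)).
    apply: contraNneq v0 => p0; apply/eqP/rowP => j; rewrite mxE.
    by have := congr1 (fun p : {poly K} => p`_j) p0; rewrite coef_poly ltn_ord inord_val coef0.
  exists [seq (\sum_j v ord0 j *: c j m, 'X_[bmnm m]) | m <- enum {: I}].
    move=> u /mapP [m _ ->] /=; rewrite /m_y raddf_sum.
    have := congr1 (fun B : 'rV_ _ => B ord0 (enum_rank m)) vA; rewrite !mxE => vA0.
    rewrite -[RHS]vA0; apply: eq_bigr => j _; rewrite [A _ _]mxE enum_rankK.
    exact: mevalZ.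
  move=> x Xx; rewrite big_map big_enum /=.
  under [RHS]eq_bigr do rewrite raddf_sum mulr_suml.
  rewrite exchange_big /= poly_def rmorph_sum horner_sum raddf_sum.
  apply: eq_bigr => j _ /=; rewrite inord_val map_polyZ map_polyXn hornerZ hornerXn /=.
  rewrite mevalM mevalC cP // mulr_sumr; apply: eq_bigr => m _.
  by rewrite mevalZ mulrA.
move=> x xJ; exists x => [i|p p0].
  have: m_y ('X_i - (y i)%:MP) by rewrite /m_y mevalB mevalXU mevalC subrr.
  move/ideal_span_gen/xJ; rewrite comp_mpolyB comp_mpolyC comp_mpolyXU.
  by rewrite -tnth_nth tnth_mktuple mevalB mevalC => /eqP; rewrite subr_eq0 => /eqP.
by apply: xJ; exists [::] => // z Xz; rewrite big_nil p0.
Qed.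
End FiniteMaps.

(** * Two by two matrices and generators of SL_2 *)

Lemma ord2P (P : 'I_2 -> Prop) : P 0 -> P 1 -> forall i, P i.
Proof.
by move=> P0 P1 [[|[|//]] hi]; [move: P0|move: P1]; congr P; apply: val_inj.
Qed.

Lemma ord4P (P : 'I_4 -> Prop) : P 0 -> P 1 -> P 2 -> P 3 -> forall i, P i.
Proof.
by move=> P0 P1 P2 P3 [[|[|[|[|//]]]] hi]; [move: P0|move: P1|move: P2|move: P3];
  congr P; apply: val_inj.
Qed.

Lemma big_ord2E (R : Type) (idx : R) (op : Monoid.law idx) (F : 'I_2 -> R) :
  \big[op/idx]_(i < 2) F i = op (F 0) (F 1).
Proof.
by rewrite !big_ord_recr big_ord0 /= Monoid.mul1m; congr (op (F _) (F _)); apply: val_inj.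
Qed.

Lemma big_ord4E (R : Type) (idx : R) (op : Monoid.law idx) (F : 'I_4 -> R) :
  \big[op/idx]_(i < 4) F i = op (op (op (F 0) (F 1)) (F 2)) (F 3).
Proof.
rewrite !big_ord_recr big_ord0 /= Monoid.mul1m.
by congr (op (op (op (F _) (F _)) (F _)) (F _)); apply: val_inj.
Qed.

Section TwoByTwo.
Variable K : fieldType.

Definition mx2 (a b c d : K) : 'M[K]_2 :=
  \matrix_(i, j) (if i == 0 then if j == 0 then a else b
                  else if j == 0 then c else d).

Lemma mx2E (A : 'M[K]_2) : A = mx2 (A 0 0) (A 0 1) (A 1 0) (A 1 1).
Proof. by apply/matrixP; apply: ord2P; apply: ord2P; rewrite mxE. Qed.

Lemma mx2M a b c d a' b' c' d' : mx2 a b c d *m mx2 a' b' c' d' =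
  mx2 (a * a' + b * c') (a * b' + b * d') (c * a' + d * c') (c * b' + d * d').
Proof. by apply/matrixP; apply: ord2P; apply: ord2P; rewrite !mxE big_ord2E !mxE. Qed.

Lemma det_mx2 a b c d : \det (mx2 a b c d) = a * d - b * c.
Proof.
rewrite (expand_det_row _ 0) big_ord2E /cofactor !det_mx11 !mxE /=.
by rewrite !expr0 expr1 !mul1r mulN1r mulrN.
Qed.

Lemma invmx_mx2 a b c d : \det (mx2 a b c d) = 1 -> invmx (mx2 a b c d) = mx2 d (- b) (- c) a.
Proof.
move=> e; have u : mx2 a b c d \in unitmx by rewrite unitmxE e unitr1.
rewrite -[RHS](mulKmx u) mx2M -[LHS]mulmx1; congr (_ *m _).
rewrite [LHS]mx2E !mxE /= -e det_mx2; congr mx2; ring.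
Qed.

(** Upper shears and the Weyl element give the lower shears by conjugation. A matrix with [c != 0]
    is a product of three shears; if [c = 0], splitting off a lower shear moves [d != 0] to the
    place of [c]. *)
Lemma SL2_ind (P : 'M[K]_2 -> Prop) :
  (forall s, P (mx2 1 s 0 1)) -> P (mx2 0 1 (-1) 0) ->
  (forall S T, \det S = 1 -> \det T = 1 -> P S -> P T -> P (S *m T)) ->
  forall S, \det S = 1 -> P S.
Proof.
move=> Pu Pw PM.
have detu s : \det (mx2 1 s 0 1) = 1 by rewrite det_mx2; ring.
have detw : \det (mx2 0 1 (-1) 0) = 1 by rewrite det_mx2; ring.
have Pl c : P (mx2 1 0 c 1).
  (* The cube of the Weyl element is its inverse, so the conjugation is a product of the given
     generators. *)
  have -> : mx2 1 0 c 1 = mx2 0 1 (-1) 0 *m (mx2 0 1 (-1) 0 *m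
      (mx2 0 1 (-1) 0 *m (mx2 1 (- c) 0 1 *m mx2 0 1 (-1) 0))).
    by rewrite !mx2M; congr mx2; ring.
  by do 3! [apply: (PM) => //; first by rewrite !det_mulmx ?detw ?detu ?mulr1];
     apply: PM.
have detl c : \det (mx2 1 0 c 1) = 1 by rewrite det_mx2; ring.
have PS a b c d : c != 0 -> a * d - b * c = 1 -> P (mx2 a b c d).
  move=> c0 e; have -> : mx2 a b c d =
      mx2 1 ((a - 1) / c) 0 1 *m (mx2 1 0 c 1 *m mx2 1 ((d - 1) / c) 0 1).
    have -> : b = (a * d - 1) / c by apply: (mulIf c0); rewrite divfK // -e; ring.
    by rewrite !mx2M; congr mx2; field.
  apply: (PM) => //; first by rewrite det_mulmx detl detu mulr1.
  exact: PM.
move=> S; rewrite [S]mx2E det_mx2; set a := S 0 0; set b := S 0 1.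
set c := S 1 0; set d := S 1 1 => e.
have [c0|c0] := eqVneq c 0; last exact: PS.
have d0 : d != 0.
  by apply: contra_eq_neq e => ->; rewrite c0 !mulr0 subrr eq_sym oner_eq0.
have -> : mx2 a b c d = mx2 (a + b) b d d *m mx2 1 0 (-1) 1.
  by rewrite mx2M c0; congr mx2; ring.
have e' : (a + b) * d - b * d = 1 by rewrite -e c0; ring.
by apply: PM; rewrite ?det_mx2 //; [ring | apply: PS].
Qed.

Definition ent (T : 'M[K]_2) : 'I_4 -> K :=
  tnth [tuple T 0 0; T 0 1; T 1 0; T 1 1].

Definition mx_ent (x : 'I_4 -> K) : 'M[K]_2 := mx2 (x 0) (x 1) (x 2) (x 3).

Lemma mx_entK T : mx_ent (ent T) = T.
Proof. by rewrite [RHS]mx2E. Qed.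

Lemma ent_mx x : ent (mx_ent x) =1 x.
Proof. by apply: ord4P; rewrite /ent /mx_ent /= !mxE. Qed.

Lemma entE a b c d : ent (mx2 a b c d) =1 tnth [tuple a; b; c; d].
Proof. by apply: ord4P; rewrite /ent /= !mxE. Qed.

Definition detP : {mpoly K[4]} := 'X_0 * 'X_3 - 'X_1 * 'X_2.

Lemma meval_detP x : detP.@[x] = \det (mx_ent x).
Proof. by rewrite det_mx2 mevalB !mevalM !mevalXU. Qed.

Definition ltrans (S : 'M[K]_2) (p : {mpoly K[4]}) : {mpoly K[4]} :=
  p \mPo [tuple S 0 0 *: 'X_0 + S 0 1 *: 'X_2; S 0 0 *: 'X_1 + S 0 1 *: 'X_3;
                S 1 0 *: 'X_0 + S 1 1 *: 'X_2; S 1 0 *: 'X_1 + S 1 1 *: 'X_3].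

Lemma meval_ltrans S p T : (ltrans S p).@[ent T] = p.@[ent (S *m T)].
Proof.
rewrite comp_mpoly_meval; apply: meval_eq; apply: ord4P.
all: by rewrite mevalD !mevalZ !mevalXU /ent !(tnth_nth 0) /= mxE big_ord2E.
Qed.

End TwoByTwo.

(** * The invariant integral on SL_2 *)
Section Haar.
Variable K : closedFieldType.
Hypothesis charK : [pchar K] =i pred0.

Lemma natr_eq0 n : (n%:R == 0 :> K) = (n == 0%N).
Proof. exact: (pcharf0P K).1. Qed.

(* The integral of [a ^ i b ^ j c ^ k d ^ l] over the compact form SU(2). *)
Definition haar_mono (i j k l : nat) : K :=
  if (i == l) && (j == k) then
    (-1) ^+ j * i`!%:R * j`!%:R / (i + j).+1`!%:R
  else 0.

Definition haar (p : {mpoly K[4]}) : K :=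
  \sum_(m <- msupp p) p@_m * haar_mono (m 0) (m 1) (m 2) (m 3).

Lemma haarwE k p : (msize p <= k)%N ->
  haar p = \sum_(m : 'X_{1..4 < k}) p@_m * haar_mono (m 0) (m 1) (m 2) (m 3).
Proof.
move=> le_pk; rewrite /haar (big_mksub 'X_{1..4 < k}) ?msupp_uniq //=; first last.
  by move=> x /msize_mdeg_lt /leq_trans; apply.
by rewrite big_rmcond //= => j /memN_msupp_eq0 ->; rewrite mul0r.
Qed.

Lemma haar_is_linear : linear_for *%R haar.
Proof.
move=> c p q; pose k := maxn (msize p) (msize q).
have kp : (msize p <= k)%N by rewrite leq_maxl.
have kq : (msize q <= k)%N by rewrite leq_maxr.
rewrite (haarwE kp) (haarwE kq) (@haarwE k); last first.
  apply: leq_trans (msizeD_le _ _) _; rewrite geq_max kq andbT.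
  exact: leq_trans (msizeZ_le _ _) kp.
rewrite mulr_sumr -big_split /=; apply: eq_bigr => m _.
by rewrite mcoeffD mcoeffZ mulrDl mulrA.
Qed.

HB.instance Definition _ := GRing.isLinear.Build K {mpoly K[4]} K *%R haar haar_is_linear.

Lemma haarZ c p : haar (c *: p) = c * haar p.
Proof. exact: linearZ. Qed.

Lemma haarX m : haar 'X_[m] = haar_mono (m 0) (m 1) (m 2) (m 3).
Proof. by rewrite /haar msuppX big_seq1 mcoeffX eqxx mul1r. Qed.

Lemma mpolyX4 (m : 'X_{1..4}) :
  'X_[m] = 'X_0 ^+ m 0 * 'X_1 ^+ m 1 * 'X_2 ^+ m 2 * 'X_3 ^+ m 3 :> {mpoly K[4]}.
Proof. by rewrite mpolyXE_id big_ord4E. Qed.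

Lemma haarX4 i j k l :
  haar ('X_0 ^+ i * 'X_1 ^+ j * 'X_2 ^+ k * 'X_3 ^+ l) = haar_mono i j k l.
Proof.
have := haarX [multinom [tuple i; j; k; l]].
by rewrite mpolyX4 !(mnm_nth 0%N).
Qed.

Lemma haar_linear_ext (F : {linear {mpoly K[4]} -> {mpoly K[4]}}) :
  (forall i j k l, haar (F ('X_0 ^+ i * 'X_1 ^+ j * 'X_2 ^+ k * 'X_3 ^+ l)) =
     haar_mono i j k l) ->
  forall p, haar (F p) = haar p.
Proof.
move=> Fm p; rewrite [p]mpolyE !linear_sum; apply: eq_bigr => m _ /=.
by rewrite linearZ_LR !haarZ mpolyX4 Fm haarX4.
Qed.

Lemma haar1 : haar 1 = 1.
Proof.
by rewrite -mpolyX0 haarX !mnm0E /haar_mono /= expr0 !mul1r invr1.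
Qed.

Lemma fact_neq0 n : n`!%:R != 0 :> K.
Proof. by rewrite natr_eq0 -lt0n fact_gt0. Qed.

(** On a monomial with [i = l] and [j = k] the two terms of the determinant contribute the fractions
    [(i + 1) / (i + j + 2)] and [(j + 1) / (i + j + 2)] of its integral. *)
Lemma haar_detP p : haar (detP K * p) = haar p.
Proof.
rewrite -[_ * p]/((detP K \*o idfun) p); apply: haar_linear_ext => i j k l /=.
have -> : detP K * ('X_0 ^+ i * 'X_1 ^+ j * 'X_2 ^+ k * 'X_3 ^+ l) =
    'X_0 ^+ i.+1 * 'X_1 ^+ j * 'X_2 ^+ k * 'X_3 ^+ l.+1 -
    'X_0 ^+ i * 'X_1 ^+ j.+1 * 'X_2 ^+ k.+1 * 'X_3 ^+ l.
  by rewrite /detP !exprS; ring.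
rewrite linearB /= !haarX4 /haar_mono !eqSS.
case: (i =P l) => [_|_] /=; last by rewrite subrr.
case: (j =P k) => [_|_] /=; last by rewrite subrr.
rewrite addSn addnS !factS exprS !natrM !mulN1r.
have h n : n.+1%:R != 0 :> K by rewrite natr_eq0.
have f0 := fact_neq0.
have h1 := h (i + j)%N; have h2 := h (i + j).+1; have h3 := f0 (i + j)%N.
move: h1 h2 h3; rewrite -!natr1 !natrD => h1 h2 h3.
by field; rewrite h3 h1 h2.
Qed.

Lemma haar_odd e p : odd e -> p \is e.-homog -> haar p = 0.
Proof.
move=> oe /dhomogP pe; rewrite /haar big_seq big1 // => m /pe me.
rewrite /haar_mono; case: andP => [[/eqP e1 /eqP e2]|_]; last by rewrite mulr0.
have {}me : mdeg m = e := me.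
move: oe; rewrite -me mdegE big_ord4E /= e1 e2.
by rewrite !oddD; case: (odd (m 3)); case: (odd (m 2)).
Qed.

Lemma meval_dhomog n e (p : {mpoly K[n]}) c x :
  p \is e.-homog -> p.@[fun i => c * x i] = c ^+ e * p.@[x].
Proof.
move/dhomogP => pe; rewrite !mevalE mulr_sumr [LHS]big_seq [RHS]big_seq.
apply: eq_bigr => m /pe <-; rewrite mulrCA; congr (_ * _).
by rewrite [X in c ^+ X](mdegE m) -prodrXr -big_split /=; apply: eq_bigr => i _; rewrite exprMn.
Qed.

Lemma sum_parity (V : nmodType) (F : nat -> V) W :
  \sum_(e < W.*2) F e = \sum_(w < W) (F w.*2 + F w.*2.+1).
Proof.
by elim: W => [|W IH]; rewrite ?big_ord0 // doubleS !big_ord_recr IH /= addrA.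
Qed.

(* On SL_2 the odd and the even part of [p] vanish separately; after padding by
   powers of the determinant the even part is homogeneous, and rescaling by square
   roots of determinants shows that it is zero as a polynomial. *)
Lemma haar_eq0 p : (forall T, \det T = 1 -> p.@[ent T] = 0) -> haar p = 0.
Proof.
move=> p0; pose W := msize p; pose P e := pihomog mdeg e p.
have Ph e : P e \is e.-homog by apply: pihomogP.
have eP : p = \sum_(w < W) (P w.*2 + P w.*2.+1).
  rewrite -(sum_parity P); apply: pihomog_partitionE.
  by rewrite -addnn leq_addr.
pose q := \sum_(w < W) detP K ^+ (W - w) * P w.*2.
have hq : haar q = haar p.
  rewrite /q eP !linear_sum; apply: eq_bigr => w _ /=.
  rewrite linearD /= (@haar_odd w.*2.+1 (P w.*2.+1)) ?oddS ?odd_double // addr0.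
  by elim: (W - w)%N => [|k IH]; rewrite ?mul1r // exprS -mulrA haar_detP.
suff q0 : q = 0 by rewrite -hq q0 linear0.
(* The factor [detP] disposes of the singular matrices, where rescaling to determinant 1 is
   impossible; it is non-zero since its value at the identity is 1. *)
suff /eqP : detP K * q = 0.
  rewrite mulf_eq0 => /orP[/eqP d0|/eqP//].
  have := meval_detP (tnth [tuple 1; 0; 0; 1 : K]).
  by rewrite d0 meval0 det_mx2 /= !(tnth_nth 0) /= => /eqP;
     rewrite mulr1 mulr0 subr0 eq_sym oner_eq0.
apply: mpoly_eq0_meval => x; rewrite mevalM; apply/eqP; rewrite mulf_eq0.
case: eqVneq => //= d0; apply/eqP; set dl := _.@[x] in d0.
have [l] : exists l : K, l ^+ 2 = dl.
  have /closed_rootP [l] : size ('X^2 - dl%:P) != 1%N by rewrite size_XnsubC.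
  by rewrite rootE hornerD hornerN hornerXn hornerC subr_eq0 => /eqP; exists l.
move=> el; have l0 : l != 0 by apply: contra_neq d0 => l0; rewrite -el l0 expr0n.
have ev c : c ^+ 2 = dl -> \sum_(w < W)
   (dl ^- w * (P w.*2).@[x] + c^-1 * dl ^- w * (P w.*2.+1).@[x]) = 0.
  move=> ec; have c0 : c != 0 by apply: contra_neq d0 => c0; rewrite -ec c0 expr0n.
  rewrite -[RHS](p0 (mx_ent (fun i => c^-1 * x i))); last first.
    have -> : \det (mx_ent (fun i => c^-1 * x i)) = c^-1 ^+ 2 * \det (mx_ent x).
      by rewrite !det_mx2; ring.
    by rewrite exprVn ec -meval_detP mulVf.
  rewrite (meval_eq _ (ent_mx _)) eP raddf_sum; apply: eq_bigr => w _ /=.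
  rewrite mevalD !(meval_dhomog _ _ (Ph _)) exprS -mul2n exprM.
  by rewrite -!exprVn -ec -exprVn.
have := ev (- l); rewrite sqrrN el => /(_ erefl) e2.
have := congr2 +%R (ev l el) e2; rewrite -big_split addr0 /= => e3.
have /eqP : \sum_(w < W) (dl ^- w * (P w.*2).@[x]) *+ 2 = 0.
  by rewrite -[RHS]e3; apply: eq_bigr => w _; rewrite invrN; ring.
rewrite sumrMnl -mulr_natr mulf_eq0 natr_eq0 orbF => /eqP e4.
apply: etrans (mulr0 (dl ^+ W)); rewrite -[X in _ = _ * X]e4 /q raddf_sum mulr_sumr /=.
apply: eq_bigr => w _; rewrite mevalM rmorphXn /= -/dl mulrA; congr (_ * _).
by rewrite expfB_cond // (negbTE d0) add0n ltnW.
Qed.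

Lemma haar_ext p q :
  (forall T, \det T = 1 -> p.@[ent T] = q.@[ent T]) -> haar p = haar q.
Proof.
move=> pq; apply/eqP; rewrite -subr_eq0 -linearB; apply/eqP/haar_eq0 => T dT.
by rewrite mevalB pq // subrr.
Qed.

Lemma sum_sign_bin n : \sum_(p < n.+1) (-1) ^+ p *+ 'C(n, p) = (n == 0%N)%:R :> K.
Proof.
rewrite -expr0n -[X in X ^+ n](subrr (1 : K)) exprDn.
by apply: eq_bigr => p _; rewrite expr1n mul1r.
Qed.

(** This is invariance under [a -> a + s c], [b -> b + s d], expanded by the binomial theorem. Only
    terms with [p + q = i - l = n] survive; their factorials combine to a constant times
    [(-1) ^ p 'C(n, p)], and these cancel unless [n = 0]. *)
Lemma haar_mono_shear s i j k l :
  \sum_(p < i.+1) \sum_(q < j.+1) s ^+ (p + q) *+ 'C(i, p) *+ 'C(j, q) *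
     haar_mono (i - p) (j - q) (k + p) (l + q) = haar_mono i j k l.
Proof.
have z p q : (p <= i)%N -> (q <= j)%N ->
    (i != l + p + q)%N || (j != k + p + q)%N ->
    haar_mono (i - p) (j - q) (k + p) (l + q) = 0.
  move=> pi qj ne; rewrite /haar_mono ifF //; apply/negbTE.
  by apply: contraL ne => /andP[/eqP ? /eqP ?]; lia.
case: (boolP ((l <= i)%N && (j == k + (i - l))%N)) => [/andP[li /eqP jk]|ne]; last first.
  rewrite [RHS]/haar_mono ifF; last by apply: contraNF ne => /andP[/eqP -> /eqP ->]; lia.
  rewrite big1 // => -[p pi] _; rewrite big1 // => -[q qj] _ /=.
  rewrite z ?mulr0 //; apply: contraR ne; rewrite negb_or !negbK.
  by move=> /andP[/eqP ? /eqP ?]; lia.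
set n := (i - l)%N in jk; have il : i = (l + n)%N by rewrite subnKC.
pose C : K := s ^+ n * (-1) ^+ k * i`!%:R * j`!%:R / (l + k + n).+1`!%:R / n`!%:R.
transitivity (\sum_(p < i.+1 | (p < n.+1)%N) C * ((-1) ^+ p *+ 'C(n, p))).
  rewrite [RHS]big_mkcond; apply: eq_bigr => -[p pi] _ /=; rewrite ltnS in pi.
  case: ifP => pn; last first.
    by rewrite big1 // => -[q qj] _ /=; rewrite z ?mulr0 //; lia.
  have qj : (n - p < j.+1)%N by lia.
  rewrite (bigD1 (Ordinal qj)) //= big1 ?addr0; last first.
    move=> [q qj'] /eqP ne; rewrite z ?mulr0 //=; apply/negPn/negP.
    rewrite negb_or !negbK => /andP[/eqP ? _]; apply: ne; apply: val_inj => /=; lia.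
  have -> : (i - p = l + (n - p))%N by lia.
  have -> : (j - (n - p) = k + p)%N by lia.
  have -> : (p + (n - p) = n)%N by lia.
  rewrite /haar_mono !eqxx /=.
  have -> : ((l + (n - p) + (k + p)) = l + k + n)%N by lia.
  have e1 : ('C(i, p) * (p`! * (l + (n - p))`!) = i`!)%N.
    by rewrite -(@bin_fact i p) //; congr (_ * (_ * _`!))%N; lia.
  have e2 : ('C(j, n - p) * ((n - p)`! * (k + p)`!) = j`!)%N.
    by rewrite -(@bin_fact j (n - p)) //; congr (_ * (_ * _`!))%N; lia.
  have e3 : ('C(n, p) * (p`! * (n - p)`!) = n`!)%N by rewrite bin_fact //; lia.
  have f0 := fact_neq0; have b0 : 'C(n, p)%:R != 0 :> K.
    by rewrite natr_eq0 -lt0n bin_gt0; lia.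
  move: e1 e2 e3 => /(congr1 (fun x => x%:R : K)) e1 /(congr1 (fun x => x%:R : K)) e2
    /(congr1 (fun x => x%:R : K)) e3; rewrite !natrM in e1 e2 e3.
  rewrite /C -e1 -e2 -e3 exprD -[_ *+ 'C(i, p)]mulr_natr.
  rewrite -[_ *+ 'C(j, _)]mulr_natr -[_ *+ 'C(n, p)]mulr_natr.
  move: (f0 (l + k + n).+1%N); move: ((l + k + n).+1`!%N%:R) => f f1.
  by field; rewrite f1 b0 !f0.
rewrite -(big_ord_widen _ (fun p => C * ((-1) ^+ p *+ 'C(n, p)))); last by lia.
rewrite -mulr_sumr sum_sign_bin; case: eqP => [n0|n0].
  rewrite mulr1 /haar_mono ifT; last by lia.
  rewrite /C n0 jk il n0 !addn0 fact0 expr0 mul1r divr1.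
  by congr (_ / _`!%:R); rewrite addnC.
by rewrite mulr0 /haar_mono ifF //; lia.
Qed.

(** The polynomials are compared only on SL_2, so [q] may be replaced by [ltrans S p], and the claim
    becomes multiplicative in [S]. A shear is the binomial identity above; the Weyl element permutes
    monomials up to sign. *)
Lemma haar_mul_left S p q : \det S = 1 ->
  (forall T, \det T = 1 -> q.@[ent T] = p.@[ent (S *m T)]) -> haar q = haar p.
Proof.
move=> dS qp; have -> : haar q = haar (ltrans S p).
  by apply: haar_ext => T dT; rewrite meval_ltrans qp.
move: S dS {q qp} p; apply: SL2_ind => [s||S T dS dT IHS IHT] p; last first.
- rewrite -[RHS]IHS -[RHS]IHT; apply: haar_ext => U dU.
  by rewrite !meval_ltrans mulmxA.
- apply: haar_linear_ext => i j k l; rewrite !mxE /= !rmorphM !rmorphXn /=.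
  rewrite !comp_mpolyXU /= !scale0r !scale1r !add0r !addr0 !scaleN1r.
  have -> : 'X_2 ^+ i * 'X_3 ^+ j * (- 'X_0) ^+ k * (- 'X_1) ^+ l = (-1) ^+ (k + l) *:
      ('X_0 ^+ k * 'X_1 ^+ l * 'X_2 ^+ i * 'X_3 ^+ j) :> {mpoly K[4]}.
    rewrite -mul_mpolyC rmorphXn rmorphN1 exprD.
    rewrite (exprNn 'X_0) (exprNn 'X_1); ring.
  rewrite haarZ haarX4 /haar_mono [k == j]eq_sym [l == i]eq_sym andbC.
  case: (i =P l) => [->|_]; case: (j =P k) => [->|_] /=; rewrite ?mulr0 //.
  rewrite !mulrA -exprD -addnA addnn -mul2n exprD exprM sqrrN expr1n expr1n mulr1.
  by rewrite [(l + k)%N]addnC -!mulrA [X in _ * X]mulrCA.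
apply: haar_linear_ext => i j k l; rewrite !mxE /= !rmorphM !rmorphXn /=.
rewrite !comp_mpolyXU /= !scale0r !scale1r !add0r.
rewrite !exprDn -(haar_mono_shear s).
rewrite big_distrlr /= !mulr_suml raddf_sum; apply: eq_bigr => u _.
rewrite !mulr_suml raddf_sum; apply: eq_bigr => v _ /=.
rewrite -haarX4 -haarZ; congr haar.
rewrite -!mul_mpolyC !mpolyCMn rmorphXn !exprMn /= !exprD; ring.
Qed.

(** Transposition turns right into left translations and exchanges the exponents [j] and [k], in
    which [haar_mono] is symmetric. *)
Lemma haar_mul_right S p q : \det S = 1 ->
  (forall T, \det T = 1 -> q.@[ent T] = p.@[ent (T *m S)]) -> haar q = haar p.
Proof.
pose tr (r : {mpoly K[4]}) : {mpoly K[4]} := r \mPo [tuple 'X_0; 'X_2; 'X_1; 'X_3].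
have trE r T : (tr r).@[ent T] = r.@[ent T^T].
  rewrite comp_mpoly_meval; apply: meval_eq.
  by apply: ord4P; rewrite (tnth_nth 0) /= mevalXU /ent !(tnth_nth 0) /= mxE.
have htr r : haar (tr r) = haar r.
  apply: haar_linear_ext => i j k l; rewrite !rmorphM !rmorphXn /= !comp_mpolyXU /=.
  rewrite [X in haar (X * _)]mulrAC haarX4 /haar_mono [k == j]eq_sym.
  by case: (i =P l); case: (j =P k) => //= -> _.
move=> dS qp; rewrite -(htr p) -(htr q).
apply: (@haar_mul_left S^T) => [|T dT]; first by rewrite det_tr.
by rewrite !trE qp ?det_tr // trmx_mul trmxK.
Qed.

End Haar.

(** * Separation of orbits by invariants *)
Section Weights.
Variables (n : nat) (w : 'I_n -> nat).

(** For the indicator weight of a block of coordinates this is the degree in that component of the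
    triple. *)
Definition wdeg (m : 'X_{1..n}) : nat := (\sum_(i < n) w i * m i)%N.

Lemma wdeg0 : wdeg 0%MM = 0%N.
Proof. by rewrite /wdeg big1 // => i _; rewrite mnm0E muln0. Qed.

Lemma wdegD m1 m2 : wdeg (m1 + m2) = (wdeg m1 + wdeg m2)%N.
Proof. by rewrite -big_split; apply: eq_bigr => i _; rewrite mnmDE mulnDr. Qed.

HB.instance Definition _ := isMeasure.Build n wdeg wdeg0 wdegD.

End Weights.

Lemma dhomog_big_prod n (mf : measure n) (R : comNzRingType) (I : Type) (r : seq I)
    (F : I -> {mpoly R[n]}) d :
  (forall i, F i \is (d i).-homog for mf) ->
  \prod_(i <- r) F i \is (\sum_(i <- r) d i)%N.-homog for mf.
Proof.
move=> Fd; apply: (big_ind2 (fun p e => p \is e.-homog for mf)) => //.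
  exact: dhomog1.
by move=> p1 d1 p2 d2; apply: dhomogM.
Qed.

Section Separation.
Variable K : closedFieldType.
Hypothesis charK : [pchar K] =i pred0.
Variables (N : nat) (theta : 'I_N -> 'I_N -> {mpoly K[4]}).

Definition act (x : 'I_N -> K) (T : 'M[K]_2) : 'I_N -> K :=
  fun i => \sum_j (theta i j).@[ent T] * x j.

Hypothesis act1 : forall x, act x 1%:M =1 x.
Hypothesis actM : forall x S T, act x (S *m T) =1 act (act x S) T.

Definition orbit_map (x : 'I_N -> K) (i : 'I_N) : {mpoly K[4]} :=
  \sum_j x j *: theta i j.

Lemma meval_orbit_map x i v : (orbit_map x i).@[v] = act x (mx_ent v) i.
Proof.
rewrite raddf_sum; apply: eq_bigr => j _ /=; rewrite mevalZ mulrC; congr (_ * _).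
by apply: meval_eq => k; rewrite ent_mx.
Qed.

Definition SL2pt (v : 'I_4 -> K) : Prop := \det (mx_ent v) = 1.

Lemma act_ext x y T : x =1 y -> act x T =1 act y T.
Proof. by move=> xy i; apply: eq_bigr => j _; rewrite xy. Qed.

Definition translate (S : 'M[K]_2) (f : {mpoly K[N]}) : {mpoly K[N]} :=
  f \mPo [tuple \sum_j (theta i j).@[ent S] *: 'X_j | i < N].

Lemma meval_translate S f x : (translate S f).@[x] = f.@[act x S].
Proof.
rewrite meval_mmap; apply: meval_eq => i; rewrite raddf_sum; apply: eq_bigr => j _ /=.
by rewrite mevalZ mevalXU.
Qed.

(** The function [f (x . T)] as a polynomial in [x] whose coefficients are polynomials in the
    entries of [T], so that the integral over [T] can be taken coefficientwise. *)
Definition generic_translate (f : {mpoly K[N]}) : {mpoly {mpoly K[4]}[N]} :=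
  mmap (fun c => (c%:MP)%:MP) (fun i => \sum_j theta i j *: 'X_j) f.

Lemma meval_map_mpoly (g : {additive {mpoly K[4]} -> K}) (p : {mpoly {mpoly K[4]}[N]}) x :
  (map_mpoly g p).@[x] = \sum_(m <- msupp p) g p@_m * 'X_[m].@[x].
Proof.
rewrite raddf_sum; apply: eq_bigr => m _ /=.
rewrite mmap1_id mevalM mevalC; congr (_ * _).
Qed.

Lemma generic_translateE f S x :
  \sum_(m <- msupp (generic_translate f))
    ((generic_translate f)@_m).@[ent S] * 'X_[m].@[x] = f.@[act x S].
Proof.
rewrite -(meval_map_mpoly (meval (ent S))) [RHS]mevalE /generic_translate /mmap.
rewrite [map_mpoly _ _]rmorph_sum rmorph_sum /=.
apply: eq_bigr => m _; rewrite [map_mpoly _ _]rmorphM rmorphM /= map_mpolyC mevalC.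
congr (_ * _); first exact: mevalC.
rewrite /mmap1 [map_mpoly _ _]rmorph_prod rmorph_prod; apply: eq_bigr => i _ /=.
rewrite [map_mpoly _ _]rmorphXn rmorphXn; congr (_ ^+ _) => /=.
rewrite [map_mpoly _ _]rmorph_sum rmorph_sum; apply: eq_bigr => j _ /=.
by rewrite -mul_mpolyC [map_mpoly _ _]rmorphM rmorphM /= map_mpolyC map_mpolyX mevalC mevalXU.
Qed.

(** The Reynolds operator. *)
Definition average (f : {mpoly K[N]}) : {mpoly K[N]} :=
  map_mpoly (@haar K) (generic_translate f).

Definition orbit_integral (x : 'I_N -> K) (f : {mpoly K[N]}) : K :=
  haar (f \mPo [tuple orbit_map x i | i < N]).

Lemma meval_orbit f x T : (f \mPo [tuple orbit_map x i | i < N]).@[ent T] = f.@[act x T].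
Proof. by rewrite meval_mmap; apply: meval_eq => i; rewrite meval_orbit_map mx_entK. Qed.

Lemma meval_average f x : (average f).@[x] = orbit_integral x f.
Proof.
rewrite /average meval_map_mpoly.
transitivity (haar (\sum_(m <- msupp (generic_translate f))
    'X_[m].@[x] *: (generic_translate f)@_m)).
  by rewrite linear_sum; apply: eq_bigr => m _ /=; rewrite haarZ mulrC.
apply: haar_ext => // T _; rewrite meval_orbit -generic_translateE raddf_sum.
by apply: eq_bigr => m _ /=; rewrite mevalZ mulrC.
Qed.

Lemma average_invariant f x S : \det S = 1 -> (average f).@[act x S] = (average f).@[x].
Proof.
move=> dS; rewrite !meval_average; apply: (haar_mul_left charK dS) => T dT.
by rewrite !meval_orbit; apply: meval_eq => i; rewrite actM.
Qed.

Lemma average_homog (w : 'I_N -> nat) m :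
  (forall i j, theta i j != 0 -> w i = w j) ->
  average 'X_[m] \is (wdeg w m).-homog for (wdeg w).
Proof.
move=> wth; have : generic_translate 'X_[m] \is (wdeg w m).-homog for (wdeg w).
  rewrite /generic_translate /mmap msuppX big_seq1 mcoeffX eqxx /= !mpolyC1 mul1r.
  apply: dhomog_big_prod => i; apply: dhomogMn; apply: rpred_sum => j _.
  have [->|/wth ->] := eqVneq (theta i j) 0; first by rewrite scale0r rpred0.
  apply: rpredZ; rewrite dhomogX /= /wdeg (bigD1 j) //= mnm1E eqxx muln1.
  rewrite big1 ?addn0 //; move=> k kj.
  by rewrite mnm1E eq_sym (negbTE kj) muln0.
move/dhomogP => h; apply/dhomogP => k; rewrite mcoeff_msupp mcoeff_map_mpoly => kn0.
by apply: h; rewrite mcoeff_msupp; apply: contraNneq kn0 => ->; apply/eqP/raddf0.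
Qed.

Section OrbitSeparation.
Variables x y : 'I_N -> K.
Hypothesis x_finite : finite_map SL2pt (orbit_map x).

Definition radical (f : {mpoly K[N]}) : Prop := forall g, orbit_integral x (f * g) = 0.

Lemma radical_ideal : ideal_pred radical.
Proof.
split=> [g|f1 f2 h1 h2 g|f h Hf g]; rewrite /orbit_integral.
- by rewrite mul0r comp_mpoly0 linear0.
- by rewrite mulrDl comp_mpolyD linearD /= [X in X + _]h1 [X in _ + X]h2 addr0.
- have -> : h * f * g = f * (h * g) by ring.
  exact: Hf.
Qed.

(** Right invariance shifts the translation from [f] to the test function, as its inverse. *)
Lemma radical_translate f S : \det S = 1 -> radical f -> radical (translate S f).
Proof.
move=> dS Hf g; have uS : S \in unitmx by rewrite unitmxE dS unitr1.
rewrite -(Hf (translate (invmx S) g)); apply: (haar_mul_right charK dS) => T dT.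
rewrite !meval_orbit !mevalM !meval_translate.
congr (_ * _); apply: meval_eq => i; first by rewrite -actM.
by rewrite -actM -mulmxA mulmxV // mulmx1.
Qed.

(* If [u] takes a non-zero value at some [S0], then evaluating at [S0] expresses
   the polynomial paired with [u] through the others and a member of [radical]. *)
Lemma radical_reduce (s : seq ({mpoly K[4]} * {mpoly K[N]})) :
  (forall S, \det S = 1 -> radical (\sum_(u <- s) u.1.@[ent S] *: u.2)) ->
  exists2 s' : seq ({mpoly K[4]} * {mpoly K[N]}),
    (forall u, u \in s' -> radical u.2) &
    forall S, \det S = 1 ->
      \sum_(u <- s) u.1.@[ent S] *: u.2 = \sum_(u <- s') u.1.@[ent S] *: u.2.
Proof.
have radB f g c : radical f -> radical g -> radical (f - c *: g).
  move=> Hf Hg; rewrite -scaleNr -mul_mpolyC.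
  by apply: (idealD radical_ideal) => //; apply: (idealM radical_ideal).
elim: {s}(size s) {-2}s (erefl (size s)) => [|k IH] [|[u f] s] //= sk rad.
  by exists [::].
have [[S0 [dS0 u0]]|nou] := classic (exists S0, \det S0 = 1 /\ u.@[ent S0] != 0); last first.
  have uS S : \det S = 1 -> u.@[ent S] = 0.
    by move=> dS; apply/eqP/negPn/negP => uS; case: nou; exists S.
  have [|S dS|s' s'r s'e] := IH s; first by case: sk.
    by have := rad S dS; rewrite big_cons /= uS // scale0r add0r.
  by exists s' => // S dS; rewrite big_cons /= uS // scale0r add0r s'e.
pose g0 := \sum_(v <- (u, f) :: s) v.1.@[ent S0] *: v.2.
have g0r : radical g0 by apply: rad.
pose s2 := [seq (v.1 - (v.1.@[ent S0] / u.@[ent S0]) *: u, v.2) | v <- s].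
have e S : \sum_(v <- s2) v.1.@[ent S] *: v.2 =
    \sum_(v <- (u, f) :: s) v.1.@[ent S] *: v.2 - (u.@[ent S] / u.@[ent S0]) *: g0.
  rewrite /g0 !big_cons big_map /= scalerDr scalerA divfK // opprD addrACA subrr add0r.
  rewrite scaler_sumr -sumrB; apply: eq_bigr => v _ /=.
  by rewrite mevalB mevalZ scalerBl scalerA; congr (_ - _ *: _); ring.
have [|S dS|s' s'r s'e] := IH s2; first by rewrite size_map; case: sk.
  by rewrite e; apply: radB => //; apply: rad.
exists (((u.@[ent S0])^-1 *: u, g0) :: s') => [v|S dS].
  by rewrite inE => /orP[/eqP->|/s'r].
rewrite [RHS]big_cons -s'e // e /= mevalZ [_^-1 * _]mulrC.
by rewrite addrCA subrr addr0.
Qed.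

Theorem orbit_separation :
  (forall f, orbit_integral x f = orbit_integral y f) ->
  forall f : {mpoly K[N]}, (forall T, \det T = 1 -> f.@[act y T] = 0) -> f.@[x] = 0.
Proof.
move=> xy f fy; apply/eqP/negPn/negP => fx.
have fr : radical f.
  move=> g; rewrite xy; apply: haar_eq0 => // T dT.
  by rewrite meval_orbit mevalM fy // mul0r.
pose gt := generic_translate f.
(* Every translate of [f] is in the radical, but the monomials occurring in it need not be; the
   reduction rewrites the whole family of translates with second components in the radical. *)
have [S dS|s sr se] := @radical_reduce [seq (gt@_m, 'X_[m]) | m <- msupp gt].
  suff -> : \sum_(u <- [seq (gt@_m, 'X_[m]) | m <- msupp gt]) u.1.@[ent S] *: u.2 =
      translate S f by apply: radical_translate.
  apply/eqP; rewrite -subr_eq0; apply/eqP/mpoly_eq0_meval => v.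
  rewrite mevalB meval_translate -generic_translateE big_map raddf_sum -sumrB big1 //.
  by move=> m _ /=; rewrite mevalZ subrr.
have {se} se S v : \det S = 1 -> f.@[act v S] = \sum_(u <- s) u.1.@[ent S] * u.2.@[v].
  move=> dS; have /(congr1 (meval v)) := se S dS; rewrite !raddf_sum big_map /=.
  under eq_bigr do rewrite mevalZ; rewrite generic_translateE => ->.
  by apply: eq_bigr => u _; rewrite mevalZ.
have [|h hr h1] := finite_map_nakayama x_finite radical_ideal.
(* Inversion on SL_2 is the adjugate, hence polynomial. The identity [f (x) = f ((x . T) . T^-1)],
   divided by the non-zero [f (x)], exhibits 1 in the extended ideal. *)
- pose adj (p : {mpoly K[4]}) : {mpoly K[4]} := p \mPo [tuple 'X_3; - 'X_1; - 'X_2; 'X_0].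
  exists [seq (u.2, (f.@[x])^-1 *: adj u.1) | u <- s].
    by move=> u /mapP [w /sr wr ->].
  move=> v dv; rewrite meval1 big_map /=.
  have uT : mx_ent v \in unitmx by rewrite unitmxE dv unitr1.
  have e u : (adj u).@[v] = u.@[ent (invmx (mx_ent v))].
    rewrite invmx_mx2 // comp_mpoly_meval; apply: meval_eq => i; rewrite entE.
    by elim/ord4P: i; rewrite !(tnth_nth 0) /= ?mevalN mevalXU.
  transitivity ((f.@[x])^-1 * f.@[act (act x (mx_ent v)) (invmx (mx_ent v))]).
    rewrite (@meval_eq _ _ _ x) ?mulVf // => i.
    by rewrite -actM mulmxV // act1.
  rewrite se ?det_inv ?dv ?invr1 // mulr_sumr; apply: eq_bigr => u _.
  rewrite mevalZ e (@meval_eq _ _ _ (act x (mx_ent v)) u.2); first by ring.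
  by move=> i; rewrite meval_orbit_map.
have : orbit_integral x h = 1.
  rewrite -haar1; apply: haar_ext => // T dT; rewrite meval_mmap meval1 h1 //.
  by rewrite /SL2pt mx_entK.
by have := hr 1; rewrite mulr1 => -> /eqP; rewrite eq_sym oner_eq0.
Qed.

End OrbitSeparation.

(** The lifted point satisfies every equation valid on [SL2pt], in particular [detP = 1], so it is a
    matrix in SL_2. *)
Lemma orbit_closed x y : finite_map SL2pt (orbit_map x) ->
  (forall f : {mpoly K[N]}, (forall T, \det T = 1 -> f.@[act x T] = 0) -> f.@[y] = 0) ->
  exists2 T, \det T = 1 & act x T =1 y.
Proof.
move=> fin cl; have [h hX|v ev v0] := finite_map_lift fin (y := y).
  apply: cl => T dT; rewrite -[RHS](hX (ent T)); last by rewrite /SL2pt mx_entK.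
  by apply: meval_eq => i; rewrite meval_orbit_map mx_entK.
exists (mx_ent v); last by move=> i; rewrite -meval_orbit_map ev.
have := v0 (detP K - 1); rewrite mevalB meval_detP meval1 => e.
apply/eqP; rewrite -subr_eq0; apply/eqP/e => z dz.
by rewrite mevalB meval_detP meval1 dz subrr.
Qed.

End Separation.

(** * The representation of SL_2 on triples of forms *)
Section LinearSubstitution.
Variable K : closedFieldType.

Lemma mpoly_ext n (p q : {mpoly K[n]}) : (forall v, p.@[v] = q.@[v]) -> p = q.
Proof.
move=> pq; apply/eqP; rewrite -subr_eq0; apply/eqP/mpoly_eq0_meval => v.
by rewrite mevalB pq subrr.
Qed.

Lemma meval_lsubst n (f : {mpoly K[n]}) T v :
  (lsubst f T).@[v] = f.@[fun i => \sum_j T i j * v j].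
Proof.
rewrite meval_mmap; apply: meval_eq => i; rewrite raddf_sum.
by apply: eq_bigr => j _ /=; rewrite mevalZ mevalXU.
Qed.

Lemma lsubstM n (f : {mpoly K[n]}) S T : lsubst f (S *m T) = lsubst (lsubst f S) T.
Proof.
apply: mpoly_ext => v; rewrite !meval_lsubst; apply: meval_eq => i.
under [RHS]eq_bigr do rewrite mulr_sumr.
rewrite exchange_big; apply: eq_bigr => k _ /=; rewrite mxE mulr_suml.
by apply: eq_bigr => j _; rewrite mulrA.
Qed.

Lemma lsubst1 n (f : {mpoly K[n]}) : lsubst f 1%:M = f.
Proof.
apply: mpoly_ext => v; rewrite meval_lsubst; apply: meval_eq => i.
rewrite (bigD1 i) //= mxE eqxx mul1r big1 ?addr0 // => j ji.
by rewrite mxE eq_sym (negbTE ji) mul0r.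
Qed.

Lemma lsubst_dhomog n d (f : {mpoly K[n]}) T : f \is d.-homog -> lsubst f T \is d.-homog.
Proof.
move/dhomogP => fd; rewrite /lsubst comp_mpolyE big_seq; apply: rpred_sum => m /fd md.
have <- : (\sum_i 1 * m i = d)%N.
  by rewrite -md /= mdegE; apply: eq_bigr => i _; rewrite mul1n.
apply: rpredZ; apply: dhomog_big_prod => i; rewrite tnth_mktuple; apply: dhomogMn.
by apply: rpred_sum => j _; apply: rpredZ; rewrite dhomogX /= mdeg1.
Qed.

Section Coordinates.
Variables n d : nat.

Definition mon (i : 'I_#|{: monom n d}|) : 'X_{1..n} := val (val (enum_val i)).

Lemma mdeg_mon i : mdeg (mon i) = d.
Proof. exact/eqP/(valP (enum_val i)). Qed.

Lemma mon_inj : injective mon.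
Proof. by move=> i j /val_inj/val_inj/enum_val_inj. Qed.

Lemma mon_surj (m : 'X_{1..n}) : mdeg m = d -> exists i, mon i = m.
Proof.
move=> md; have lt : (mdeg m < d.+1)%N by rewrite md.
have md' : mdeg (BMultinom lt) == d by apply/eqP.
by exists (enum_rank (Sub (BMultinom lt) md' : monom n d)); rewrite /mon enum_rankK.
Qed.

Definition of_coords (x : 'I_#|{: monom n d}| -> K) : {mpoly K[n]} :=
  \sum_i x i *: 'X_[mon i].

Lemma of_coords_homog x : of_coords x \is d.-homog.
Proof. by apply: rpred_sum => i _; apply: rpredZ; rewrite dhomogX /= mdeg_mon. Qed.

Lemma of_coordsK x : coords (of_coords x) =1 x.
Proof.
move=> i; rewrite /coords -/(mon i) raddf_sum (bigD1 i) //= mcoeffZ mcoeffX eqxx mulr1.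
rewrite big1 ?addr0 // => j ji; rewrite mcoeffZ mcoeffX (inj_eq mon_inj).
by rewrite (negbTE ji) mulr0.
Qed.

Lemma coordsK f : f \is d.-homog -> of_coords (coords f) = f.
Proof.
move=> fd; apply/mpolyP=> m; have [md|md] := eqVneq (mdeg m) d; last first.
  by rewrite !(dhomog_nemf_coeff _ md) ?of_coords_homog.
by have [i <-] := mon_surj md; apply: (of_coordsK (coords f) i).
Qed.

Lemma coords_inj f g : f \is d.-homog -> g \is d.-homog ->
  @coords K n d f =1 coords g -> f = g.
Proof.
move=> /coordsK {2}<- /coordsK {2}<- fg.
by apply: eq_bigr => i _; rewrite fg.
Qed.

End Coordinates.

Definition var4 (k l : 'I_2) : {mpoly K[4]} :=
  'X_(if k == 0 then if l == 0 then 0 else 1 else if l == 0 then 2 else 3).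

Lemma meval_var4 T k l : (var4 k l).@[ent T] = T k l.
Proof. by move: k l; apply: ord2P; apply: ord2P; rewrite /var4 /= mevalXU. Qed.

(** The matrix, in the monomial basis, of substitution by the generic matrix [var4]. *)
Definition theta_form d (i j : 'I_#|{: monom 2 d}|) : {mpoly K[4]} :=
  (\prod_k (\sum_l var4 k l *: 'X_l) ^+ mon j k : {mpoly {mpoly K[4]}[2]})@_(mon i).

Lemma meval_theta_form d i j T :
  (@theta_form d i j).@[ent T] = (lsubst 'X_[mon j] T)@_(mon i).
Proof.
rewrite -(mcoeff_map_mpoly (meval (ent T))); congr (_@_ _).
rewrite rmorph_prod /lsubst comp_mpolyX; apply: eq_bigr => k _ /=.
rewrite rmorphXn tnth_mktuple; congr (_ ^+ _) => /=.
rewrite rmorph_sum; apply: eq_bigr => l _ /=.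
by rewrite map_mpolyZ map_mpolyX /= meval_var4.
Qed.

Lemma coords_lsubst d (f : {mpoly K[2]}) T i : f \is d.-homog ->
  coords (d := d) (lsubst f T) i = \sum_j (theta_form i j).@[ent T] * coords f j.
Proof.
move/coordsK => {1}<-; rewrite /coords -/(mon i) /lsubst /of_coords [_ \mPo _]raddf_sum raddf_sum.
apply: eq_bigr => j _ /=; rewrite comp_mpolyZ mcoeffZ meval_theta_form mulrC.
by congr (_ * _).
Qed.

End LinearSubstitution.

Section Triples.
Variable K : closedFieldType.
Local Notation N := (n8 + n4 + 1)%N.

Definition theta (i j : 'I_N) : {mpoly K[4]} :=
  match split i, split j with
  | inl i', inl j' => match split i', split j' with
                      | inl k, inl l => theta_form K k l
                      | inr k, inr l => theta_form K k l
                      | _, _ => 0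
                      end
  | inr _, inr _ => 1
  | _, _ => 0
  end.

Definition ix8 (k : 'I_n8) : 'I_N := lshift 1 (lshift n4 k).
Definition ix4 (k : 'I_n4) : 'I_N := lshift 1 (rshift n8 k).
Definition ix0 : 'I_N := rshift (n8 + n4) ord0.

Lemma split_lshift m n (i : 'I_m) : split (lshift n i) = inl i.
Proof. exact: (unsplitK (inl i)). Qed.

Lemma split_rshift m n (i : 'I_n) : split (rshift m i) = inr i.
Proof. exact: (unsplitK (inr i)). Qed.

Definition splitE := (split_lshift, split_rshift).

Lemma ixP (P : 'I_N -> Prop) :
  (forall k, P (ix8 k)) -> (forall k, P (ix4 k)) -> P ix0 -> forall i, P i.
Proof.
move=> P8 P4 P0 i; rewrite -(splitK i); case: (split i) => [j|j] /=; last by rewrite (ord1 j).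
by rewrite -(splitK j); case: (split j) => k /=; [apply: P8|apply: P4].
Qed.

Lemma sum_ix (V : nmodType) (F : 'I_N -> V) :
  \sum_i F i = \sum_k F (ix8 k) + \sum_k F (ix4 k) + F ix0.
Proof. by rewrite big_split_ord big_split_ord /= big_ord1. Qed.

Lemma sum_ixn (F : 'I_N -> nat) :
  (\sum_i F i = \sum_k F (ix8 k) + \sum_k F (ix4 k) + F ix0)%N.
Proof. by rewrite big_split_ord big_split_ord /= big_ord1. Qed.

Lemma tcoords8 (b : triple K) k : tcoords b (ix8 k) = coords b.1.1 k.
Proof. by rewrite /tcoords !splitE. Qed.

Lemma tcoords4 (b : triple K) k : tcoords b (ix4 k) = coords b.1.2 k.
Proof. by rewrite /tcoords !splitE. Qed.

Lemma tcoords0 (b : triple K) : tcoords b ix0 = b.2.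
Proof. by rewrite /tcoords !splitE. Qed.

Definition tcoordsE := (tcoords8, tcoords4, tcoords0).

Lemma tcoords_tsubst (b : triple K) T : is_form_triple b ->
  tcoords (tsubst b T) =1 act theta (tcoords b) T.
Proof.
move=> [b8 b4] i; rewrite /act sum_ix; elim/ixP: i => [k|k|]; rewrite !tcoordsE /=.
- rewrite [X in _ + X + _]big1 ?addr0 => [|l _]; last first.
    by rewrite /theta !splitE meval0 mul0r.
  rewrite [X in _ + X](_ : _ = 0) ?addr0; last by rewrite /theta !splitE meval0 mul0r.
  rewrite coords_lsubst //; apply: eq_bigr => l _.
  by rewrite tcoords8 /theta !splitE.
- rewrite [X in X + _ + _]big1 ?add0r => [|l _]; last first.
    by rewrite /theta !splitE meval0 mul0r.
  rewrite [X in _ + X](_ : _ = 0) ?addr0; last by rewrite /theta !splitE meval0 mul0r.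
  rewrite coords_lsubst //; apply: eq_bigr => l _.
  by rewrite tcoords4 /theta !splitE.
rewrite !big1 ?add0r => [|l _|l _]; try by rewrite /theta !splitE meval0 mul0r.
by rewrite /theta !splitE meval1 mul1r.
Qed.

Lemma tsubst_form (b : triple K) T : is_form_triple b -> is_form_triple (tsubst b T).
Proof. by move=> [b8 b4]; split; apply: lsubst_dhomog. Qed.

Lemma tsubstM (b : triple K) S T : tsubst b (S *m T) = tsubst (tsubst b S) T.
Proof. by rewrite /tsubst !lsubstM. Qed.

Lemma tsubst1 (b : triple K) : tsubst b 1%:M = b.
Proof. by rewrite /tsubst !lsubst1; case: b => [[]]. Qed.

Definition of_tcoords (x : 'I_N -> K) : triple K :=
  (of_coords (fun k => x (ix8 k)), of_coords (fun k => x (ix4 k)), x ix0).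

Lemma of_tcoords_form x : is_form_triple (of_tcoords x).
Proof. by split; apply: of_coords_homog. Qed.

Lemma of_tcoordsK x : tcoords (of_tcoords x) =1 x.
Proof. by apply: ixP => [k|k|]; rewrite !tcoordsE //= of_coordsK. Qed.

Lemma tcoords_inj (b c : triple K) : is_form_triple b -> is_form_triple c ->
  tcoords b =1 tcoords c -> b = c.
Proof.
move: b c => [[b8 b4] b0] [[c8 c4] c0] [/= hb8 hb4] [/= hc8 hc4] e.
have e8 : b8 = c8.
  by apply: (coords_inj hb8 hc8) => k; have := e (ix8 k); rewrite !tcoords8.
have e4 : b4 = c4.
  by apply: (coords_inj hb4 hc4) => k; have := e (ix4 k); rewrite !tcoords4.
have e0 : b0 = c0 by have := e ix0; rewrite !tcoords0.
by rewrite e8 e4 e0.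
Qed.

Lemma theta_act1 x : act theta x 1%:M =1 x.
Proof.
move=> i; have fx := of_tcoords_form x.
transitivity (tcoords (tsubst (of_tcoords x) 1%:M) i); last by rewrite tsubst1 of_tcoordsK.
by rewrite tcoords_tsubst //; apply: act_ext => j; rewrite of_tcoordsK.
Qed.

Lemma theta_actM x S T : act theta x (S *m T) =1 act theta (act theta x S) T.
Proof.
move=> i; have fx := of_tcoords_form x.
transitivity (tcoords (tsubst (of_tcoords x) (S *m T)) i).
  by rewrite tcoords_tsubst //; apply: act_ext => j; rewrite of_tcoordsK.
rewrite tsubstM tcoords_tsubst; last exact: tsubst_form.
apply: act_ext => j; rewrite tcoords_tsubst //.
by apply: act_ext => k; rewrite of_tcoordsK.
Qed.

Hypothesis charK : [pchar K] =i pred0.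

Definition wt8 (i : 'I_N) : nat :=
  if split i is inl i' then if split i' is inl _ then 1 else 0 else 0.
Definition wt4 (i : 'I_N) : nat :=
  if split i is inl i' then if split i' is inr _ then 1 else 0 else 0.
Definition wt0 (i : 'I_N) : nat := if split i is inr _ then 1 else 0.

Lemma theta_block i j : theta i j != 0 ->
  [/\ wt8 i = wt8 j, wt4 i = wt4 j & wt0 i = wt0 j].
Proof.
rewrite /theta /wt8 /wt4 /wt0.
by case: (split i) => i'; case: (split j) => j'; rewrite ?eqxx //;
  case: (split i') => ?; case: (split j') => ?; rewrite ?eqxx.
Qed.

Lemma average_multihomog m : multihomog (average theta 'X_[m]).
Proof.
exists (wdeg wt8 m), (wdeg wt4 m), (wdeg wt0 m) => k km.
have h w : (forall i j, theta i j != 0 -> w i = w j) -> wdeg w k = wdeg w m.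
  by move=> /(average_homog m)/dhomogP; apply.
have h8 := h wt8 (fun i j ij => let: And3 e _ _ := theta_block ij in e).
have h4 := h wt4 (fun i j ij => let: And3 _ e _ := theta_block ij in e).
have h0 := h wt0 (fun i j ij => let: And3 _ _ e := theta_block ij in e).
have E8 : (forall l, wt8 (ix8 l) = 1%N) * (forall l, wt8 (ix4 l) = 0%N) * (wt8 ix0 = 0%N).
  by split; [split=> l|]; rewrite /wt8 !splitE.
have E4 : (forall l, wt4 (ix8 l) = 0%N) * (forall l, wt4 (ix4 l) = 1%N) * (wt4 ix0 = 0%N).
  by split; [split=> l|]; rewrite /wt4 !splitE.
have E0 : (forall l, wt0 (ix8 l) = 0%N) * (forall l, wt0 (ix4 l) = 0%N) * (wt0 ix0 = 1%N).
  by split; [split=> l|]; rewrite /wt0 !splitE.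
have sum01 (I : finType) (v g : I -> nat) (e : bool) : (forall i, v i = e) ->
    (\sum_i v i * g i = if e then \sum_i g i else 0)%N.
  move=> ve; case: e ve => ve; first by apply: eq_bigr => i _; rewrite ve mul1n.
  by apply: big1 => i _; rewrite ve.
split; rewrite -?h8 -?h4 -?h0 /wdeg sum_ixn.
- by rewrite (sum01 _ _ _ true E8.1.1) (sum01 _ _ _ false E8.1.2) E8.2 mul0n !addn0.
- by rewrite (sum01 _ _ _ false E4.1.1) (sum01 _ _ _ true E4.1.2) E4.2 mul0n addn0.
by rewrite (sum01 _ _ _ false E0.1.1) (sum01 _ _ _ false E0.1.2) E0.2 mul1n.
Qed.

Lemma average_joint_invariant m : joint_invariant (average theta 'X_[m]).
Proof.
split=> [|b T bf dT]; first exact: average_multihomog.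
rewrite -(average_invariant charK theta_actM _ (tcoords b) dT).
by apply: meval_eq; apply: tcoords_tsubst.
Qed.

(** The average of an arbitrary [f] need not be multihomogeneous, so the hypothesis is applied to
    averages of monomials and extended by linearity. *)
Lemma same_orbit_integral (b c : triple K) :
  (forall j, joint_invariant j -> j.@[tcoords b] = j.@[tcoords c]) ->
  forall f, orbit_integral theta (tcoords b) f = orbit_integral theta (tcoords c) f.
Proof.
move=> bc f; have e x : orbit_integral theta x f =
    \sum_(m <- msupp f) f@_m * orbit_integral theta x 'X_[m].
  rewrite /orbit_integral {1}[f]mpolyE [_ \mPo _]raddf_sum linear_sum.
  by apply: eq_bigr => m _ /=; rewrite comp_mpolyZ haarZ.
rewrite !e; apply: eq_bigr => m _; congr (_ * _).
have := bc _ (average_joint_invariant m).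
by rewrite !meval_average.
Qed.

End Triples.

(** * Spans under products and substitutions, and Bezout relations *)

Section MoreSpan.
Variables (K : closedFieldType) (n N : nat).
Variables (X : ('I_n -> K) -> Prop) (phi : 'I_N -> {mpoly K[n]}).
Local Notation in_span := (in_span X phi).

Lemma in_span_exp D g k : in_span D g -> in_span (D * k) (fun x => g x ^+ k).
Proof.
move=> gD; elim: k => [|k IH].
  rewrite muln0; apply: in_span_ext (in_spanA X phi 1) => x _.
  by rewrite meval1 expr0.
rewrite mulnS; apply: in_span_ext (in_spanM gD IH) => x _.
by rewrite exprS.
Qed.

Lemma in_span_prod (I : Type) (r : seq I) (D : I -> nat) (g : I -> ('I_n -> K) -> K) :
  (forall i, in_span (D i) (g i)) ->
  in_span (\sum_(i <- r) D i) (fun x => \prod_(i <- r) g i x).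
Proof.
move=> gD; elim: r => [|i r IH].
  rewrite big_nil; apply: in_span_ext (in_spanA X phi 1) => x _.
  by rewrite meval1 big_nil.
rewrite big_cons; apply: in_span_ext (in_spanM (gD i) IH) => x _.
by rewrite big_cons.
Qed.

Lemma in_span_monomial M (m : 'X_{1..M}) (g : 'I_M -> ('I_n -> K) -> K) :
  (forall i, in_span 1 (g i)) -> in_span (mdeg m) (fun x => 'X_[m].@[fun i => g i x]).
Proof.
move=> g1; rewrite mdegE.
apply: (@in_span_ext _ _ _ _ _ _ (fun x => \prod_i g i x ^+ m i)) => [x _|].
  by rewrite mevalX.
apply: in_span_prod => i; apply: in_span_le (in_span_exp (m i) (g1 i)).
by rewrite mul1n.
Qed.

Lemma in_span_dhomog M e (p : {mpoly K[M]}) (g : 'I_M -> ('I_n -> K) -> K) :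
  p \is e.-homog -> (forall i, in_span 1 (g i)) ->
  in_span e (fun x => p.@[fun i => g i x]).
Proof.
move/dhomogP => pe g1.
apply: (@in_span_ext _ _ _ _ _ _ (fun x => \sum_(m <- msupp p | mdeg m == e)
    p@_m * 'X_[m].@[fun i => g i x])) => [x _|].
  rewrite mevalE big_seq_cond [RHS]big_seq; apply: eq_big => [m|m _]; last by rewrite mevalX.
  by apply: andb_idr => /pe /eqP.
by apply: in_span_sum => m /eqP <-; apply/in_spanZ/in_span_monomial.
Qed.

Lemma in_span_var i : in_span 1 (fun x => x i).
Proof.
rewrite -[1%N](mdeg1 i); apply: in_span_ext (in_spanX X phi U_(i)) => x _.
exact: mevalXU.
Qed.

End MoreSpan.

Lemma in_span_comp (K : closedFieldType) n n' N N' (X : ('I_n -> K) -> Prop)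
    (X' : ('I_n' -> K) -> Prop) (phi : 'I_N -> {mpoly K[n]}) (phi' : 'I_N' -> {mpoly K[n']})
    (f : ('I_n' -> K) -> 'I_n -> K) (H : 'I_N -> {mpoly K[N']}) D g :
  (forall x, X' x -> X (f x)) -> (forall i, in_span X' phi' 1 (fun x => f x i)) ->
  (forall x i, X' x -> (phi i).@[f x] = (H i).@[fun j => (phi' j).@[x]]) ->
  in_span X phi D g -> in_span X' phi' D (fun x => g (f x)).
Proof.
move=> XX' f1 phiH [s sD sg].
apply: (@in_span_ext _ _ _ _ _ _ (fun x => \sum_(u <- s | (mdeg u.2 <= D)%N)
   (u.1 \mPo [tuple H i | i < N]).@[fun j => (phi' j).@[x]] * 'X_[u.2].@[f x])).
  move=> x X'x; rewrite sg; last exact: XX'.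
  rewrite [LHS]big_seq_cond [RHS]big_seq; apply: eq_big => [u|u _].
    by apply: andb_idr => us; apply: (allP sD).
  rewrite meval_mmap; congr (_ * _); apply: meval_eq => i.
  by rewrite phiH.
apply: in_span_sum => u uD; apply: in_span_le uD _.
by apply: (in_spanM (in_spanA _ _ _)); apply: in_span_monomial.
Qed.

(** Iterated gcds give a combination dividing every [q i]; without a common root it is a non-zero
    constant. *)
Lemma bezout_family (K : closedFieldType) (I : eqType) (s : seq I) (q : I -> {poly K}) :
  uniq s -> (forall r, exists2 i, i \in s & (q i).[r] != 0) ->
  exists u : I -> {poly K}, \sum_(i <- s) u i * q i = 1.
Proof.
move=> us qr.
have [u ug] : exists u : I -> {poly K}, forall i, i \in s -> \sum_(j <- s) u j * q j %| q i.
  elim: {qr}s us => [|i s IH] /=; first by exists (fun=> 0).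
  case/andP=> is_ /IH [u uP]; have [[a b] /= ab] := Bezoutp (q i) (\sum_(j <- s) u j * q j).
  pose v j := if j == i then a else b * u j.
  exists v; have -> : \sum_(j <- i :: s) v j * q j = a * q i + b * \sum_(j <- s) u j * q j.
    rewrite big_cons {1}/v eqxx; congr (_ + _); rewrite mulr_sumr big_seq [RHS]big_seq.
    apply: eq_bigr => j js; rewrite /v mulrA; case: eqP => // ji.
    by rewrite ji (negbTE is_) in js.
  move=> j; rewrite (eqp_dvdl _ ab) inE => /orP[/eqP->|js]; first exact: dvdp_gcdl.
  exact: dvdp_trans (dvdp_gcdr _ _) (uP j js).
pose g := \sum_(j <- s) u j * q j; have [sg|/closed_rootP [r gr]] := eqVneq (size g) 1%N.
  have /eqP/size_poly1P [c c0 gc] := sg; exists (fun i => c^-1%:P * u i).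
  under eq_bigr do rewrite -mulrA.
  by rewrite -mulr_sumr -/g gc -polyCM mulVf.
have [i is_ /negP[]] := qr r; rewrite -/(root (q i) r) -dvdp_XsubCl.
by apply: dvdp_trans (ug i is_); rewrite dvdp_XsubCl.
Qed.

(** * Stable triples *)
Section StableTriples.
Variable K : closedFieldType.
Local Notation N := (n8 + n4 + 1)%N.

(* By the Hilbert-Mumford criterion, non-stable triples are those in the SL_2-orbit
   of a degenerate one: a linear form divides b8 four times and b4 twice. *)
Definition degenerate (b : triple K) : Prop :=
  forall m : 'X_{1..2}, (m 1%R < m 0%R)%N -> b.1.1@_m = 0 /\ b.1.2@_m = 0.

Definition stable_triple (b : triple K) : Prop :=
  forall S : 'M[K]_2, \det S = 1 -> ~ degenerate (tsubst b S).

Lemma stable_tsubst b S : \det S = 1 -> stable_triple b -> stable_triple (tsubst b S).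
Proof.
move=> dS bS T dT; rewrite -tsubstM; apply: bS.
by rewrite det_mulmx dS dT mulr1.
Qed.

Definition exp0 (i : 'I_N) : nat :=
  match split i with
  | inl i' => match split i' with inl k => mon k 0%R | inr k => mon k 0%R end
  | inr _ => 0
  end.

Definition form_degree (i : 'I_N) : nat :=
  match split i with
  | inl i' => match split i' with inl k => 8 | inr k => 4 end
  | inr _ => 0
  end.

(** The condition [m 1 < m 0] of [degenerate], rewritten with [m 0 + m 1 = form_degree]; in this
    form it is the degree estimate of [stable_chart]. *)
Definition high (i : 'I_N) : bool := (form_degree i < 2 * exp0 i)%N.

Lemma mon_sum d (k : 'I_#|{: monom 2 d}|) : (mon k 0%R + mon k 1%R)%N = d.
Proof. by rewrite -[RHS](mdeg_mon k) mdegE big_ord2E. Qed.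

Lemma exp0_le i : (exp0 i <= 8)%N.
Proof.
elim/ixP: i => [k|k|]; rewrite /exp0 ?splitE //=.
  by rewrite -[X in (_ <= X)%N](mon_sum k) leq_addr.
by apply: (@leq_trans 4) => //; rewrite -[X in (_ <= X)%N](mon_sum k) leq_addr.
Qed.

Lemma degenerate_tcoords b : is_form_triple b ->
  (forall i, high i -> tcoords b i = 0) -> degenerate b.
Proof.
move=> [b8 b4] bh m m01; split.
  have [md|md] := eqVneq (mdeg m) 8%N; last exact: dhomog_nemf_coeff b8 md.
  have [k e] := mon_surj md; have := bh (ix8 k).
  rewrite tcoords8 /coords -/(mon k) e; apply.
  rewrite /high /exp0 /form_degree /ix8 !splitE -[X in (X < _)%N](mon_sum k) e.
  by rewrite mul2n -addnn ltn_add2l.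
have [md|md] := eqVneq (mdeg m) 4%N; last exact: dhomog_nemf_coeff b4 md.
have [k e] := mon_surj md; have := bh (ix4 k).
rewrite tcoords4 /coords -/(mon k) e; apply.
rewrite /high /exp0 /form_degree /ix4 !splitE -[X in (X < _)%N](mon_sum k) e.
by rewrite mul2n -addnn ltn_add2l.
Qed.

Lemma lsubst_diag (f : {mpoly K[2]}) s t m :
  (lsubst f (mx2 s 0 0 t))@_m = s ^+ m 0 * t ^+ m 1 * f@_m.
Proof.
rewrite /lsubst comp_mpolyE [in RHS](mpolyE f) !raddf_sum mulr_sumr.
apply: eq_bigr => k _ /=; rewrite !mcoeffZ big_ord2E !tnth_mktuple !big_ord2E !mxE /=.
rewrite !scale0r addr0 add0r !exprZn -scalerAl -scalerAr scalerA mcoeffZ.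
have -> : 'X_0 ^+ k 0 * 'X_1 ^+ k 1 = 'X_[k] :> {mpoly K[2]}.
  by rewrite [RHS]mpolyXE_id big_ord2E.
rewrite mcoeffX; case: (k =P m) => [->|_]; last by rewrite !mulr0.
by rewrite !mulr1 mulrC.
Qed.

Lemma tcoords_diag (b : triple K) t i :
  tcoords (tsubst b (mx2 t 0 0 1)) i = t ^+ exp0 i * tcoords b i.
Proof.
elim/ixP: i => [k|k|]; rewrite /exp0 ?tcoords8 ?tcoords4 ?tcoords0 ?splitE /=.
- by rewrite /coords lsubst_diag expr1n mulr1.
- by rewrite /coords lsubst_diag expr1n mulr1.
by rewrite mul1r.
Qed.

Lemma coef_dhomog_prod (I : Type) (r : seq I) (F : I -> {mpoly {mpoly K[4]}[2]}) (d : I -> nat) :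
  (forall i m, (F i)@_m \is (d i).-homog) ->
  forall m, (\prod_(i <- r) F i)@_m \is (\sum_(i <- r) d i)%N.-homog.
Proof.
move=> Fd; elim: r => [|i r IH] m.
  rewrite !big_nil mcoeff1; case: eqP => _; [exact: dhomog1 | exact: dhomog0].
by rewrite !big_cons mcoeffM; apply: rpred_sum => k _; apply: dhomogM.
Qed.

Lemma theta_form_dhomog d (k l : 'I_#|{: monom 2 d}|) : theta_form K k l \is d.-homog.
Proof.
have e : (\sum_i \sum_(j < mon l i) 1 = d)%N.
  rewrite -[RHS](mdeg_mon l) mdegE; apply: eq_bigr => i _.
  by rewrite sum_nat_const card_ord muln1.
suff : theta_form K k l \is (\sum_i \sum_(j < mon l i) 1)%N.-homog by rewrite e.
rewrite /theta_form {e}.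
apply: (@coef_dhomog_prod _ _ _ (fun i => \sum_(j < mon l i) 1)%N) => i m.
rewrite -[X in _ ^+ X]card_ord -prodr_const.
apply: (@coef_dhomog_prod _ _ _ (fun=> 1%N)) => _ m'.
rewrite raddf_sum; apply: rpred_sum => j _ /=; rewrite mcoeffZ mcoeffX.
case: eqP => _; rewrite ?mulr1 ?mulr0; last exact: dhomog0.
by rewrite /var4 dhomogX /= mdeg1.
Qed.

Lemma theta_dhomog i j : theta K i j \is (form_degree i).-homog.
Proof.
rewrite /theta /form_degree; case: (split i) => [i'|_]; case: (split j) => [j'|_] /=.
- case: (split i') => k; case: (split j') => l /=;
  by rewrite ?dhomog0 ?theta_form_dhomog.
- exact: dhomog0.
- exact: dhomog0.
exact: dhomog1.
Qed.

Local Notation orbit b := (orbit_map (theta K) (tcoords b)).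
Local Notation spanned b := (in_span (@SL2pt K) (orbit b)).

Definition homogenization (u : {poly K}) (E : nat) (v : 'I_4 -> K) : K :=
  \sum_(j < E.+1) u`_j * (v 0 ^+ (E - j) * v 2 ^+ j).

Lemma homogenizationE (u : {poly K}) E (v : 'I_4 -> K) : (size u <= E.+1)%N -> v 0 != 0 ->
  homogenization u E v = v 0 ^+ E * u.[v 2 / v 0].
Proof.
move=> uE v0; rewrite (horner_coef_wide _ uE) mulr_sumr; apply: eq_bigr => j _.
have jE : (j <= E)%N by rewrite -ltnS.
move: (nat_of_ord j) jE => {}j jE.
have -> : v 0 ^+ E = v 0 ^+ (E - j) * v 0 ^+ j by rewrite -exprD subnK.
by rewrite expr_div_n; field; rewrite expf_neq0.
Qed.

Lemma homogenization_span (b : triple K) (u : {poly K}) E : spanned b E (homogenization u E).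
Proof.
apply: in_span_sum => j _; apply: in_spanZ.
have jE : (j <= E)%N by rewrite -ltnS.
have h := in_spanM (in_span_exp (E - j) (in_span_var (@SL2pt K) (orbit b) 0))
  (in_span_exp j (in_span_var (@SL2pt K) (orbit b) 2)).
by apply: in_span_le h; rewrite !mul1n subnK.
Qed.

Lemma tcoords_horner (b : triple K) : is_form_triple b ->
  exists q : 'I_N -> {poly K}, forall i r, (q i).[r] = tcoords (tsubst b (mx2 1 0 r 1)) i.
Proof.
move=> bf; have /fin_all_exists [q qP] : forall i, exists q : {poly K}, forall r,
    q.[r] = tcoords (tsubst b (mx2 1 0 r 1)) i.
  move=> i; have [q qP] := meval_poly (orbit b i) (tnth [tuple 1; 0; 'X; 1]).
  exists q => r; rewrite qP tcoords_tsubst // -[in RHS](mx_entK (mx2 1 0 r 1)).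
  rewrite -meval_orbit_map; apply: meval_eq => k; rewrite entE.
  by elim/ord4P: k; rewrite !(tnth_nth 0) /= ?hornerC ?hornerX.
by exists q.
Qed.

(* With [v = (a, b', c, d)], the triple [b.T.(a, -b'; 0, a)] has coordinates of
   degree [form_degree i] over the orbit coordinates, but its matrix is
   [(a^2, 0; a c, 1)], so for [a != 0] they equal [a ^ (2 exp0 i)] times the
   coordinates of [b.(1, 0; c/a, 1)]. *)
Lemma shear_coords_span (b : triple K) i : is_form_triple b ->
  spanned b (form_degree i) (fun v =>
    tcoords (tsubst b (mx2 (v 0 ^+ 2) 0 (v 0 * v 2) 1)) i).
Proof.
move=> bf; pose M (v : 'I_4 -> K) := mx2 (v 0) (- v 1) 0 (v 0).
apply: (@in_span_ext _ _ _ _ _ _ (fun v =>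
  \sum_j (theta K i j).@[ent (M v)] * (orbit b j).@[v])) => [v dv|].
  transitivity (tcoords (tsubst (tsubst b (mx_ent v)) (M v)) i).
    rewrite tcoords_tsubst; last exact: tsubst_form.
    by apply: eq_bigr => j _; rewrite meval_orbit_map tcoords_tsubst.
  rewrite -tsubstM /mx_ent /M mx2M; congr (tcoords (tsubst b _) i).
  move: dv; rewrite /SL2pt det_mx2 => <-; congr mx2; ring.
apply: in_span_sum => j _; rewrite -[form_degree i]addn0; apply: in_spanM; last first.
  apply: in_span_ext (in_spanA _ _ 'X_j) => v _; exact: mevalXU.
apply: (@in_span_ext _ _ _ _ _ _ (fun v =>
  (theta K i j).@[fun k => tnth [tuple v 0; - v 1; 0; v 0] k])) => [v _|].
  by apply: meval_eq => k; rewrite /M entE.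
apply: in_span_dhomog; first exact: theta_dhomog.
apply: ord4P; rewrite /=.
- exact: in_span_var.
- apply: in_span_ext (in_spanZ (-1) (in_span_var _ _ 1)) => v _.
  by rewrite mulN1r.
- exact: in_span0.
exact: in_span_var.
Qed.

(** By stability the high coordinates of [b . (1, 0; r, 1)] have no common zero [r], which gives a
    Bezout relation. At [r = c / a], multiplied by [a ^ (Q + 1)], its terms have degree
    [1 + (Q - 2 exp0 i) + form_degree i], and this is at most [Q] because [i] is high. *)
Lemma stable_chart b : is_form_triple b -> stable_triple b ->
  exists Q, spanned b Q (fun v => v 0 ^+ Q.+1).
Proof.
move=> bf bS; have [q qP] := tcoords_horner bf.
have [u uP] : exists u : 'I_N -> {poly K}, \sum_(i <- enum high) u i * q i = 1.
  apply: bezout_family => [|r]; first exact: enum_uniq.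
  apply: NNPP => no; apply: (bS (mx2 1 0 r 1)); first by rewrite det_mx2; ring.
  apply: degenerate_tcoords => [|i hi]; first exact: tsubst_form.
  rewrite -qP; apply/eqP/negPn/negP => qi; case: no; exists i => //.
  by rewrite mem_enum.
pose U := (\max_(i : 'I_N) size (u i))%N.
(* The summand 16 bounds [2 * exp0 i], so [Q - 2 * exp0 i] is a true difference, with room for the
   degree of each [u i]. *)
have [Q eQ] : exists Q, Q = (16 + U)%N by exists (16 + U)%N.
have uQ i : (size (u i) <= (Q - 2 * exp0 i).+1)%N.
  apply: leq_trans (_ : U <= _)%N; first exact: leq_bigmax.
  by have := exp0_le i; rewrite eQ; lia.
exists Q; apply: (@in_span_ext _ _ _ _ _ _ (fun v => \sum_(i <- enum high)
    v 0 * (homogenization (u i) (Q - 2 * exp0 i) v *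
    tcoords (tsubst b (mx2 (v 0 ^+ 2) 0 (v 0 * v 2) 1)) i))) => [v dv|].
  (* Thanks to the extra factor [v 0] both sides vanish at [v 0 = 0], where [c / a] has no
     meaning. *)
  have [v0|v0] := eqVneq (v 0) 0.
    by rewrite big1 ?v0 ?expr0n // => i _; rewrite mul0r.
  rewrite -mulr_sumr [RHS]exprS; congr (_ * _).
  have := congr1 (horner^~ (v 2 / v 0)) uP; rewrite hornerC horner_sum => e.
  rewrite -[RHS]mulr1 -[X in _ = _ * X]e mulr_sumr; apply: eq_bigr => i _.
  rewrite homogenizationE // hornerM qP.
  have -> : mx2 (v 0 ^+ 2) 0 (v 0 * v 2) 1 = mx2 1 0 (v 2 / v 0) 1 *m mx2 (v 0 ^+ 2) 0 0 1.
    by rewrite mx2M; congr mx2; field.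
  have e2 : (Q - 2 * exp0 i + 2 * exp0 i = Q)%N.
    by have := exp0_le i; rewrite eQ; lia.
  by rewrite tsubstM tcoords_diag -exprM -[in RHS]e2 exprD mulrACA.
apply: (@in_span_ext _ _ _ _ _ _ (fun v => \sum_(i in high)
    v 0 * (homogenization (u i) (Q - 2 * exp0 i) v *
    tcoords (tsubst b (mx2 (v 0 ^+ 2) 0 (v 0 * v 2) 1)) i))) => [v _|].
  by rewrite big_enum.
apply: in_span_sum => i; rewrite unfold_in => hi.
have := in_spanM (in_span_var (@SL2pt K) (orbit b) 0)
  (in_spanM (homogenization_span b (u i) (Q - 2 * exp0 i)) (shear_coords_span i bf)).
apply: in_span_le; have := exp0_le i; move: hi; rewrite /high eQ; lia.
Qed.

(** At the matrix [L v R], the orbit map of [b . L^-1] gives [(b . v) . R], whose coordinates are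
    linear in those of [b . v]. *)
Lemma span_translate (b : triple K) L R Q g : is_form_triple b -> \det L = 1 -> \det R = 1 ->
  spanned (tsubst b (invmx L)) Q g ->
  spanned b Q (fun v => g (ent (L *m mx_ent v *m R))).
Proof.
move=> bf dL dR; have uL : L \in unitmx by rewrite unitmxE dL unitr1.
apply: (in_span_comp (H := fun i => \sum_j (theta K i j).@[ent R] *: 'X_j)).
- by move=> v dv; rewrite /SL2pt mx_entK !det_mulmx dL dR dv !mulr1.
- have lin i j : spanned b 1 (fun v => (L *m mx_ent v *m R) i j).
    apply: (@in_span_ext _ _ _ _ _ _ (fun v =>
       \sum_l \sum_k L i k * R l j * v (if k == 0 then if l == 0 then 0 else 1
          else if l == 0 then 2 else 3))) => [v _|].
      rewrite mxE; apply: eq_bigr => l _; rewrite !mxE mulr_suml; apply: eq_bigr => k _.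
      rewrite mulrAC; congr (_ * _); rewrite mxE.
      by case: ifP; case: ifP.
    apply: in_span_sum => l _; apply: in_span_sum => k _.
    exact/in_spanZ/in_span_var.
  by apply: ord4P; rewrite /ent /=; apply: lin.
move=> v i _; rewrite meval_orbit_map mx_entK raddf_sum /=.
have e : tcoords (tsubst (tsubst b (invmx L)) (L *m mx_ent v *m R)) i =
    act (theta K) (act (theta K) (tcoords b) (mx_ent v)) R i.
  rewrite -tsubstM -mulmxA mulKmx // tsubstM tcoords_tsubst; last exact: tsubst_form.
  by apply: act_ext => j; rewrite tcoords_tsubst.
rewrite -tcoords_tsubst; last exact: tsubst_form.
by rewrite e; apply: eq_bigr => j _; rewrite mevalZ mevalXU meval_orbit_map.
Qed.

(** Multiplication by the Weyl element on either side brings each of the four entries, up to sign,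
    to the corner treated by [stable_chart]. *)
Lemma stable_finite_map b : is_form_triple b -> stable_triple b ->
  finite_map (@SL2pt K) (orbit b).
Proof.
move=> bf bS; apply: finite_map_criterion.
pose w : 'M[K]_2 := mx2 0 1 (-1) 0.
have dw : \det w = 1 by rewrite det_mx2; ring.
have d1 : \det (1%:M : 'M[K]_2) = 1 by rewrite det1.
have chart L R : \det L = 1 -> \det R = 1 ->
    exists Q, spanned b Q (fun v => (L *m mx_ent v *m R) 0 0 ^+ Q.+1).
  move=> dL dR; have dL' : \det (invmx L) = 1 by rewrite det_inv dL invr1.
  have [Q HQ] := stable_chart (tsubst_form (invmx L) bf) (stable_tsubst dL' bS).
  exists Q; exact: (span_translate bf dL dR HQ).
have /fin_all_exists [Q QP] : forall i : 'I_4, exists Q, spanned b Q (fun v => v i ^+ Q.+1).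
  apply: ord4P.
  - have [Q HQ] := chart _ _ d1 d1; exists Q; apply: in_span_ext HQ => v _.
    by rewrite mul1mx mulmx1 mxE.
  - have [Q HQ] := chart _ _ d1 dw; exists Q.
    apply: in_span_ext (in_spanZ ((-1) ^+ Q.+1) HQ) => v _.
    rewrite mul1mx mx2M mxE /= -exprMn; congr (_ ^+ _); ring.
  - have [Q HQ] := chart _ _ dw d1; exists Q; apply: in_span_ext HQ => v _.
    rewrite mulmx1 mx2M mxE /=; congr (_ ^+ _); ring.
  have [Q HQ] := chart _ _ dw dw; exists Q.
  apply: in_span_ext (in_spanZ ((-1) ^+ Q.+1) HQ) => v _.
  rewrite !mx2M mxE /= -exprMn; congr (_ ^+ _); ring.
exists (\max_i Q i)%N => i; have le := leq_bigmax i : (Q i <= _)%N.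
have h := in_spanM (in_span_exp (\max_i Q i - Q i) (in_span_var (@SL2pt K) (orbit b) i)) (QP i).
apply: in_span_le (in_span_ext _ h); first by rewrite mul1n subnK.
by move=> v _; rewrite -exprD addnS subnK.
Qed.

End StableTriples.

(** * Limits under one-parameter tori *)

Section TorusLimits.
Variable K : closedFieldType.

(** Since [0 ^+ 0 = 1], the limit point keeps exactly the coordinates of weight 0. *)
Lemma torus_limit n (p : {mpoly K[n]}) (w : 'I_n -> nat) x c :
  (forall t, t != 0 -> p.@[fun i => t ^+ w i * x i] = c) ->
  p.@[fun i => 0 ^+ w i * x i] = c.
Proof.
move=> pc; have [q qP] := meval_poly p (fun i => x i *: 'X^(w i)).
have e t : p.@[fun i => t ^+ w i * x i] = q.[t].
  by rewrite qP; apply: meval_eq => i; rewrite hornerZ hornerXn mulrC.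
by rewrite e; apply: horner_punctured => t /pc; rewrite e.
Qed.

Lemma lsubst_diag_mx n (f : {mpoly K[n]}) (d : 'I_n -> K) m :
  (lsubst f (diag_mx (\row_i d i)))@_m = (\prod_i d i ^+ m i) * f@_m.
Proof.
have e i : \sum_(j < n) (diag_mx (\row_i d i)) i j *: 'X_j = d i *: 'X_i :> {mpoly K[n]}.
  rewrite (bigD1 i) //= !mxE eqxx mulr1n big1 ?addr0 // => j ji.
  by rewrite !mxE eq_sym (negbTE ji) mulr0n scale0r.
rewrite /lsubst comp_mpolyE [in RHS](mpolyE f) !raddf_sum mulr_sumr.
apply: eq_bigr => k _ /=; rewrite !mcoeffZ.
under eq_bigr do rewrite tnth_mktuple e exprZn.
have -> : \prod_(i < n) (d i ^+ k i *: 'X_i ^+ k i) =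
    (\prod_(i < n) d i ^+ k i) *: 'X_[k] :> {mpoly K[n]}.
  by rewrite scaler_prod -mpolyXE_id.
rewrite mcoeffZ mcoeffX; case: (k =P m) => [->|_]; last by rewrite !mulr0.
by rewrite !mulr1 mulrC.
Qed.

End TorusLimits.

Lemma mcoeff_mulXn (R : nzRingType) n (g : {mpoly R[n]}) i k (m : 'X_{1..n}) :
  (m i < k)%N -> (g * 'X_i ^+ k)@_m = 0.
Proof.
move=> mk; apply: memN_msupp_eq0; rewrite mpolyXn (perm_mem (msuppMX _ _)).
apply/negP => /mapP [m' _ e]; move: mk; rewrite e mnmDE mulmnE mnm1E eqxx mul1n.
by rewrite ltnNge leq_addr.
Qed.

(** * Powers of binary quadrics and degenerations of unstable triples *)

Section UnstableFibre.
Variable K : closedFieldType.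
Hypothesis charK : [pchar K] =i pred0.
Local Notation N := (n8 + n4 + 1)%N.

Definition binary_quadric (R : nzRingType) (a b c : R) : {mpoly R[2]} :=
  a *: 'X_[U_(0) + U_(0)] + b *: 'X_[U_(0) + U_(1)] + c *: 'X_[U_(1) + U_(1)].

Lemma map_binary_quadric (R S : nzRingType) (f : {rmorphism R -> S}) a b c :
  map_mpoly f (binary_quadric a b c) = binary_quadric (f a) (f b) (f c).
Proof. by rewrite !raddfD /= !map_mpolyZ !map_mpolyX. Qed.

Lemma meval_binary_quadric (R : comNzRingType) (a b c : R) v :
  (binary_quadric a b c).@[v] = a * (v 0 * v 0) + b * (v 0 * v 1) + c * (v 1 * v 1).
Proof. by rewrite !mevalD !mevalZ !mpolyXD !mevalM !mevalXU. Qed.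

(** The parameters are the values of the quadric at the points (1,0), (0,1), (1,1), which makes
    finiteness of the power map visible. *)
Definition quadric (x : 'I_3 -> K) : {mpoly K[2]} :=
  binary_quadric (x 0) (x 2 - x 0 - x 1) (x 1).

Definition power_triple (c d e : K) (q : {mpoly K[2]}) : triple K :=
  (c *: q ^+ 4, d *: q ^+ 2, e).

Lemma quadric_homog x : quadric x \is 2.-homog.
Proof.
by rewrite !rpredD ?rpredZ // dhomogX /= mdegD !mdeg1.
Qed.

Lemma power_triple_form c d e x : is_form_triple (power_triple c d e (quadric x)).
Proof.
by split; apply: rpredZ; [apply: (dhomogMn 4 (quadric_homog x))|
  apply: (dhomogMn 2 (quadric_homog x))].
Qed.

Lemma ord3P (P : 'I_3 -> Prop) : P 0 -> P 1 -> P 2 -> forall i, P i.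
Proof.
by move=> P0 P1 P2 [[|[|[|//]]] hi]; [move: P0|move: P1|move: P2];
  congr P; apply: val_inj.
Qed.

Definition test_point (i : 'I_3) : 'I_2 -> K :=
  fun k => if k == 0 then (i != 1)%:R else (i != 0)%:R.

Lemma test_pointE : (test_point 0 0 = 1) * (test_point 0 1 = 0) *
  (test_point 1 0 = 0) * (test_point 1 1 = 1) *
  (test_point 2 0 = 1) * (test_point 2 1 = 1).
Proof. by []. Qed.

Lemma meval_quadric x i : (quadric x).@[test_point i] = x i.
Proof.
by rewrite meval_binary_quadric; elim/ord3P: i; rewrite !test_pointE; ring.
Qed.

Lemma power_map c d e : exists phi : 'I_N -> {mpoly K[3]},
  forall x i, (phi i).@[x] = tcoords (power_triple c d e (quadric x)) i.
Proof.
pose q : {mpoly {mpoly K[3]}[2]} := binary_quadric 'X_0 ('X_2 - 'X_0 - 'X_1) 'X_1.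
have qx x : map_mpoly (meval x) q = quadric x.
  by rewrite map_binary_quadric /= !mevalB !mevalXU.
have qn x k m : ((q ^+ k)@_m).@[x] = (quadric x ^+ k)@_m.
  by rewrite -(mcoeff_map_mpoly (meval x)) rmorphXn /= qx.
have /fin_all_exists [phi phiP] : forall i : 'I_N, exists p : {mpoly K[3]},
    forall x, p.@[x] = tcoords (power_triple c d e (quadric x)) i.
  apply: ixP => [k|k|].
  - exists (c *: (q ^+ 4)@_(mon k)) => x.
    by rewrite tcoords8 /coords /= mcoeffZ mevalZ qn.
  - exists (d *: (q ^+ 2)@_(mon k)) => x.
    by rewrite tcoords4 /coords /= mcoeffZ mevalZ qn.
  by exists e%:MP => x; rewrite tcoords0 mevalC.
by exists phi => x i.
Qed.

(* Both [q ^ 4] and [q ^ 2] determine the values of [q] at three points up to roots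
   of unity, so that the parametrization by [q] is a finite map. *)
Lemma power_map_finite c d e phi : (c != 0) || (d != 0) ->
  (forall x i, (phi i).@[x] = tcoords (power_triple c d e (quadric x)) i) ->
  finite_map (fun=> True) phi.
Proof.
move=> cd phiP; apply: finite_map_criterion.
have span0 (v : 'I_2 -> K) :
    in_span (fun=> True) phi 0 (fun x => (c *: quadric x ^+ 4).@[v]) /\
    in_span (fun=> True) phi 0 (fun x => (d *: quadric x ^+ 2).@[v]).
  split.
    apply: (@in_span_ext _ _ _ _ _ _ (fun x =>
        \sum_k 'X_[mon k].@[v] * ('X_(ix8 k)).@[fun j => (phi j).@[x]])) => [x _|].
      have [h8 _] := power_triple_form c d e x.
      rewrite -[c *: _](coordsK h8) /of_coords raddf_sum; apply: eq_bigr => k _ /=.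
      by rewrite mevalZ mulrC mevalXU phiP tcoords8.
    by apply: in_span_sum => k _; apply/in_spanZ/in_spanA.
  apply: (@in_span_ext _ _ _ _ _ _ (fun x =>
      \sum_k 'X_[mon k].@[v] * ('X_(ix4 k)).@[fun j => (phi j).@[x]])) => [x _|].
    have [_ h4] := power_triple_form c d e x.
    rewrite -[d *: _](coordsK h4) /of_coords raddf_sum; apply: eq_bigr => k _ /=.
    by rewrite mevalZ mulrC mevalXU phiP tcoords4.
  by apply: in_span_sum => k _; apply/in_spanZ/in_spanA.
have [c0|c0] := eqVneq c 0.
  have d0 : d != 0 by move: cd; rewrite c0 eqxx.
  exists 1%N => i; apply: (@in_span_le _ _ _ _ _ 0) => //.
  apply: in_span_ext (in_spanZ d^-1 (span0 (test_point i)).2) => x _.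
  by rewrite mevalZ rmorphXn /= meval_quadric mulKf.
exists 3 => i; apply: (@in_span_le _ _ _ _ _ 0) => //.
apply: in_span_ext (in_spanZ c^-1 (span0 (test_point i)).1) => x _.
by rewrite mevalZ rmorphXn /= meval_quadric mulKf.
Qed.

Lemma lsubst_quadric x S : lsubst (quadric x) S =
  quadric (fun i => (quadric x).@[fun k => \sum_l S k l * test_point i l]).
Proof.
apply: mpoly_ext => v; rewrite meval_lsubst.
rewrite !meval_binary_quadric !big_ord2E !test_pointE.
rewrite /=; ring.
Qed.

(** A zero of the quadric is moved to the first basis vector; it is (0,1) if [x 1 = 0], and (1,r)
    for a root [r] otherwise. *)
Lemma quadric_isotropic x : exists2 S : 'M[K]_2, \det S = 1 &
  exists l : {mpoly K[2]}, lsubst (quadric x) S = l * 'X_1.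
Proof.
have [S dS S0] : exists2 S : 'M[K]_2, \det S = 1 & (quadric x).@[fun k => S k 0] = 0.
  have [x1|x1] := eqVneq (x 1) 0.
    exists (mx2 0 (-1) 1 0); first by rewrite det_mx2; ring.
    rewrite meval_binary_quadric !mxE /= x1; ring.
  pose p := x 1 *: 'X^2 + ((x 2 - x 0 - x 1) *: 'X + (x 0)%:P).
  have /closed_rootP [r pr] : size p != 1%N.
    rewrite size_polyDl size_scale ?size_polyXn //.
    apply: leq_ltn_trans (size_polyD _ _) _; rewrite gtn_max.
    rewrite (leq_ltn_trans (size_scale_leq _ _)) ?size_polyX //=.
    by rewrite (leq_ltn_trans (size_polyC_leq1 _)).
  exists (mx2 1 0 r 1); first by rewrite det_mx2; ring.
  move/rootP: pr; rewrite !hornerD !hornerZ hornerXn hornerX hornerC => <-.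
  rewrite meval_binary_quadric !mxE /=; ring.
exists S => //; rewrite lsubst_quadric.
pose y i := (quadric x).@[fun k => \sum_l S k l * test_point i l]; rewrite -/y.
have y0 : y 0 = 0.
  rewrite /y -[RHS]S0; apply: meval_eq => k; rewrite big_ord2E !test_pointE /=; ring.
exists ((y 2 - y 0 - y 1) *: 'X_0 + y 1 *: 'X_1).
rewrite /quadric /binary_quadric y0 scale0r add0r !mpolyXD -!mul_mpolyC; ring.
Qed.

Lemma tsubst_power_triple c d e q S :
  tsubst (power_triple c d e q) S = power_triple c d e (lsubst q S).
Proof. by rewrite /tsubst /power_triple /lsubst /= !comp_mpolyZ !rmorphXn. Qed.

Lemma power_triple_unstable c d e x : ~ stable_triple (power_triple c d e (quadric x)).
Proof.
have [S dS [l lS]] := quadric_isotropic x; move/(_ S dS); apply.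
apply: degenerate_tcoords => [|i]; first exact/tsubst_form/power_triple_form.
rewrite tsubst_power_triple lS.
elim/ixP: i => [k|k|]; rewrite /high /form_degree /exp0 ?splitE //= => hk.
  rewrite tcoords8 /coords /= -/(mon k) mcoeffZ exprMn mcoeff_mulXn ?mulr0 //.
  by have := mon_sum k; move: hk; lia.
rewrite tcoords4 /coords /= -/(mon k) mcoeffZ exprMn mcoeff_mulXn ?mulr0 //.
by have := mon_sum k; move: hk; lia.
Qed.

(** Truncated subtraction is harmless: on a degenerate triple the coordinates of negative weight are
    zero. *)
Definition torus_weight (i : 'I_N) : nat :=
  match split i with
  | inl i' => match split i' with
              | inl k => mon k 1%R - mon k 0%R
              | inr k => mon k 1%R - mon k 0%R
              end
  | inr _ => 0
  end.

Lemma mcoeff_diag (f : {mpoly K[2]}) (t : K) (m : 'X_{1..2}) : t != 0 ->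
  ((m 1%R < m 0%R)%N -> f@_m = 0) ->
  (lsubst f (mx2 t^-1 0 0 t))@_m = t ^+ (m 1%R - m 0%R) * f@_m.
Proof.
move=> t0 fm; rewrite lsubst_diag.
have [/fm ->|m01] := ltnP (m 1%R) (m 0%R); first by rewrite !mulr0.
congr (_ * _); rewrite exprVn -[in LHS](subnK m01) exprD mulrCA mulVf ?mulr1 //.
by rewrite expf_neq0.
Qed.

Lemma tcoords_torus (b : triple K) t i : degenerate b -> t != 0 ->
  tcoords (tsubst b (mx2 t^-1 0 0 t)) i = t ^+ torus_weight i * tcoords b i.
Proof.
move=> bd t0; elim/ixP: i => [k|k|]; rewrite /torus_weight ?tcoordsE ?splitE /=.
- by rewrite /coords mcoeff_diag // => /bd [].
- by rewrite /coords mcoeff_diag // => /bd [].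
by rewrite mul1r.
Qed.

(** In the two forms weight 0 leaves only the monomials [(z_1 z_2)^4] and [(z_1 z_2)^2], powers of
    the quadric [z_1 z_2]. *)
Lemma degenerate_limit (b : triple K) : is_form_triple b -> degenerate b ->
  exists c d e, tcoords (power_triple c d e (binary_quadric 0 1 0)) =1
    (fun i => 0 ^+ torus_weight i * tcoords b i).
Proof.
move=> [b8 b4] bd; pose m n : 'X_{1..2} := ((U_(0%R) + U_(1%R)) *+ n)%MM.
have m0 n : (m n 0%R = n) * (m n 1%R = n).
  by rewrite !mulmnE !mnmDE !mnm1E; split; rewrite /= mul1n.
have e2 n : binary_quadric 0 1 0 ^+ n = 'X_[m n] :> {mpoly K[2]}.
  by rewrite /binary_quadric !scale0r scale1r addr0 add0r mpolyXn.
have eqm n (k : 'X_{1..2}) : mdeg k = (2 * n)%N -> (m n == k) = (k 0%R == k 1%R).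
  rewrite mdegE big_ord2E /= => kn; apply/eqP/eqP => [<-|k01]; first by rewrite !m0.
  by apply/mnmP; apply: ord2P; rewrite m0; lia.
have key n (f : {mpoly K[2]}) (k : 'X_{1..2}) : mdeg k = (2 * n)%N ->
    ((k 1%R < k 0%R)%N -> f@_k = 0) ->
    (f@_(m n) *: binary_quadric 0 1 0 ^+ n)@_k = 0 ^+ (k 1%R - k 0%R) * f@_k.
  move=> kn fk; rewrite e2 mcoeffZ mcoeffX eqm //.
  case: (ltngtP (k 0%R) (k 1%R)) => [lt|/fk ->|e].
  - by rewrite mulr0 expr0n subn_eq0 leqNgt lt mul0r.
  - by rewrite !mulr0.
  have /eqP <- : m n == k by rewrite eqm // e.
  by rewrite !m0 subnn expr0 mulr1 mul1r.
exists (b.1.1@_(m 4)), (b.1.2@_(m 2)), b.2 => i.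
elim/ixP: i => [k|k|]; rewrite /torus_weight ?tcoordsE ?splitE /=.
- by rewrite /coords key ?mdeg_mon // => /bd [].
- by rewrite /coords key ?mdeg_mon // => /bd [].
by rewrite mul1r.
Qed.

Lemma orbit_integral_ext f (x y : 'I_N -> K) : x =1 y ->
  orbit_integral (theta K) x f = orbit_integral (theta K) y f.
Proof. by move=> xy; rewrite -!meval_average //; apply: meval_eq. Qed.

Lemma orbit_integral_degenerate (b : triple K) : is_form_triple b -> degenerate b ->
  exists c d e, forall f, orbit_integral (theta K) (tcoords b) f =
    orbit_integral (theta K) (tcoords (power_triple c d e (binary_quadric 0 1 0))) f.
Proof.
move=> bf bd; have [c [d [e lim]]] := degenerate_limit bf bd.
exists c, d, e => f; rewrite (orbit_integral_ext f lim) -!meval_average //; apply/esym.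
apply: torus_limit => t t0; have dt : \det (mx2 t^-1 0 0 t) = 1.
  by rewrite det_mx2 mulVf // mulr0 subr0.
rewrite -(average_invariant charK (@theta_actM K) f (tcoords b) dt).
by apply: meval_eq => i; rewrite -tcoords_tsubst // tcoords_torus.
Qed.

(* If [b'] is not stable, then [b] lies in the closure of the orbit of a triple of
   powers of a quadric; such triples form a closed set without stable elements. *)
Lemma stable_fibre (b b' : triple K) : is_form_triple b -> is_form_triple b' ->
  stable_triple b ->
  (forall f, orbit_integral (theta K) (tcoords b') f =
             orbit_integral (theta K) (tcoords b) f) ->
  stable_triple b'.
Proof.
move=> bf b'f bS bb' S dS deg.
have [c [d [e lim]]] := orbit_integral_degenerate (tsubst_form S b'f) deg.
set b0 := power_triple _ _ _ _ in lim.
have b0q : b0 = power_triple c d e (quadric (tnth [tuple 0; 0; 1])).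
  by rewrite /b0 /quadric !(tnth_nth 0) /= !subr0.
have b0f : is_form_triple b0 by rewrite b0q; apply: power_triple_form.
have sep := orbit_separation charK (@theta_act1 K) (@theta_actM K)
  (stable_finite_map bf bS) (y := tcoords b0).
have {}sep f : (forall T, \det T = 1 -> f.@[act (theta K) (tcoords b0) T] = 0) ->
    f.@[tcoords b] = 0.
  apply: sep => g; rewrite -bb' -lim -!meval_average //.
  rewrite -(average_invariant charK (@theta_actM K) g (tcoords b') dS).
  by apply: meval_eq => i; rewrite tcoords_tsubst.
have orb T : exists x, tsubst b0 T = power_triple c d e (quadric x).
  by rewrite b0q tsubst_power_triple lsubst_quadric; eexists.
(* For [c = d = 0] the parametrization by quadrics is not finite, but then all high coordinates
   vanish on the orbit of [b0], hence at [b], which would be degenerate. *)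
have [cd|] := boolP ((c != 0) || (d != 0)); last first.
  rewrite negb_or !negbK => /andP[/eqP c0 /eqP d0].
  apply: (bS 1%:M); rewrite ?det1 // tsubst1; apply: degenerate_tcoords => // i hi.
  rewrite -(mevalXU (tcoords b) i); apply: sep => T dT; rewrite mevalXU.
  rewrite -tcoords_tsubst //; have [x ->] := orb T; rewrite c0 d0.
  elim/ixP: i hi => [k|k|]; rewrite ?tcoordsE /=; last by rewrite /high /exp0 ?splitE.
    by rewrite /coords scale0r mcoeff0.
  by rewrite /coords scale0r mcoeff0.
have [phi phiP] := power_map c d e.
have [h h0|x xb _] := finite_map_lift (power_map_finite cd phiP) (y := tcoords b).
  apply: sep => T dT; have [x ex] := orb T; rewrite -[RHS](h0 x I).
  by apply: meval_eq => i; rewrite phiP -ex tcoords_tsubst.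
apply: (@power_triple_unstable c d e x).
suff -> : power_triple c d e (quadric x) = b by [].
apply: tcoords_inj => // [|i]; first exact: power_triple_form.
by rewrite -phiP xb.
Qed.

End UnstableFibre.

(** * Ternary quartics *)
Lemma big_ord3E (R : Type) (idx : R) (op : Monoid.law idx) (F : 'I_3 -> R) :
  \big[op/idx]_(i < 3) F i = op (op (F 0) (F 1)) (F 2).
Proof.
rewrite !big_ord_recr big_ord0 /= Monoid.mul1m.
by congr (op (op (F _) (F _)) (F _)); apply: val_inj.
Qed.

Section ChainRule.
Variables (K : closedFieldType) (n : nat).

Lemma mpoly_alg_ind (P : {mpoly K[n]} -> Prop) :
  (forall c, P c%:MP) -> (forall i, P 'X_i) ->
  (forall p q, P p -> P q -> P (p + q)) -> (forall p q, P p -> P q -> P (p * q)) ->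
  forall p, P p.
Proof.
move=> PC PX PD PM p; rewrite [p]mpolyE.
apply: big_ind => [|p1 p2|m _]; [by rewrite -mpolyC0 | exact: PD |].
rewrite -mul_mpolyC; apply: (PM) => //; rewrite mpolyXE_id.
apply: big_ind => [|p1 p2|i _]; [by rewrite -mpolyC1 | exact: PM |].
elim: (m i) => [|k IH]; first by rewrite expr0 -mpolyC1.
by rewrite exprS; apply: PM.
Qed.

Lemma mderiv_lsubst (f : {mpoly K[n]}) M j :
  (lsubst f M)^`M(j) = \sum_i M i j *: lsubst f^`M(i) M.
Proof.
have lM : {morph (fun f : {mpoly K[n]} => lsubst f M) : f g / f * g}.
  by move=> p q; rewrite /lsubst rmorphM.
have lD : {morph (fun f : {mpoly K[n]} => lsubst f M) : f g / f + g}.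
  by move=> p q; rewrite /lsubst comp_mpolyD.
elim/mpoly_alg_ind: f => [c|i|p q IHp IHq|p q IHp IHq].
- rewrite /lsubst comp_mpolyC mderivC big1 // => i _.
  by rewrite mderivC comp_mpoly0 scaler0.
- rewrite /lsubst comp_mpolyXU -tnth_nth tnth_mktuple raddf_sum /=.
  have dX k l : ('X_k : {mpoly K[n]})^`M(l) = (k == l)%:R%:MP.
    rewrite mderivX mnm1E; case: eqP => [->|_]; last by rewrite scale0r mpolyC0.
    have -> : (U_(l) - U_(l))%MM = 0%MM :> 'X_{1..n}.
      by apply/mnmP => a; rewrite mnmBE subnn mnm0E.
    by rewrite mpolyX0 scale1r mpolyC1.
  rewrite (bigD1 j) //= [in RHS](bigD1 i) //= !mderivZ !dX !eqxx comp_mpolyC.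
  rewrite !big1 ?addr0 // => k ki; rewrite ?mderivZ dX.
    by rewrite eq_sym (negbTE ki) comp_mpolyC mpolyC0 scaler0.
  by rewrite (negbTE ki) mpolyC0 scaler0.
- rewrite lD mderivD IHp IHq -big_split; apply: eq_bigr => i _ /=.
  by rewrite mderivD lD scalerDr.
rewrite lM mderivM IHp IHq mulr_suml mulr_sumr -big_split; apply: eq_bigr => i _ /=.
by rewrite mderivM lD !lM scalerDr scalerAl scalerAr.
Qed.

End ChainRule.

Section Quartics.
Variable K : closedFieldType.
Hypothesis charK : [pchar K] =i pred0.

Definition mon3 (t : nat * nat * nat) : 'X_{1..3} := [multinom [tuple t.1.1; t.1.2; t.2]].

Definition exponents4 : seq (nat * nat * nat) :=
  [:: (4, 0, 0); (3, 1, 0); (3, 0, 1); (2, 2, 0); (2, 1, 1); (2, 0, 2); (1, 3, 0);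
      (1, 2, 1); (1, 1, 2); (1, 0, 3); (0, 4, 0); (0, 3, 1); (0, 2, 2); (0, 1, 3);
      (0, 0, 4)]%N.

Lemma mon3E i j k : (mon3 (i, j, k) 0%R = i) * (mon3 (i, j, k) 1%R = j) * (mon3 (i, j, k) 2%R = k).
Proof. by rewrite /mon3 !(mnm_nth 0%N). Qed.

Lemma quarticE (F : {mpoly K[3]}) : F \is 4.-homog ->
  F = \sum_(t <- exponents4) F@_(mon3 t) *: 'X_[mon3 t].
Proof.
move=> F4; apply/mpolyP => m; rewrite raddf_sum /=.
have -> : m = mon3 (m 0, m 1, m 2).
  by apply/mnmP; apply: ord3P; rewrite mon3E.
move: (m 0) (m 1) (m 2) => i j k.
under eq_bigr do rewrite mcoeffZ mcoeffX.
have inj t : (mon3 t == mon3 (i, j, k)) = (t == (i, j, k)).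
  apply/eqP/eqP => [e|-> //]; case: t e => [[a b] c] e.
  have := congr1 (fun m : 'X_{1..3} => (m 0, m 1, m 2)) e.
  by rewrite !mon3E.
under eq_bigr do rewrite inj.
have [tin|tnin] := boolP ((i, j, k) \in exponents4).
  rewrite (bigD1_seq (i, j, k)) //= eqxx mulr1 big1 ?addr0 // => t ne.
  by rewrite (negbTE ne) mulr0.
rewrite big1_seq => [|t /andP[_ ts]]; last first.
  by case: eqP ts => [->|_ _]; [rewrite (negbTE tnin)|rewrite mulr0].
apply: dhomog_nemf_coeff F4 _; apply: contra tnin => /=.
rewrite mdegE big_ord3E /= !mon3E => /eqP e.
have -> : k = (4 - (i + j))%N by lia.
have : (i + j <= 4)%N by lia.
by clear; case: i => [|[|[|[|[|i]]]]]; case: j => [|[|[|[|[|j]]]]].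
Qed.

Lemma quartic_meval (F : {mpoly K[3]}) x : F \is 4.-homog ->
  F.@[x] = \sum_(t <- exponents4) F@_(mon3 t) * (x 0 ^+ t.1.1 * x 1 ^+ t.1.2 * x 2 ^+ t.2).
Proof.
move=> F4; rewrite {1}(quarticE F4) raddf_sum; apply: eq_bigr => -[[i j] k] _ /=.
by rewrite mevalZ mevalX big_ord3E /= !mon3E.
Qed.

Lemma mderiv2X (m : 'X_{1..3}) a b x :
  (('X_[m] : {mpoly K[3]})^`M(a)^`M(b)).@[x] =
  (m a)%:R * (m b - (a == b))%:R * 'X_[m - U_(a) - U_(b)].@[x].
Proof. by rewrite mderivX mderivZ mevalZ mderivX mevalZ mnmBE mnm1E mulrA. Qed.

(** Up to sign, the operator obtained from the quadric [v_2^2 - v_1 v_3] by putting derivatives for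
    the [v_i]. *)
Definition laplacian (F : {mpoly K[3]}) : {mpoly K[3]} :=
  F^`M(0)^`M(2) - F^`M(1)^`M(1).

Lemma laplacian_meval (F : {mpoly K[3]}) x : F \is 4.-homog ->
  (laplacian F).@[x] = \sum_(t <- exponents4) F@_(mon3 t) *
    ((t.1.1 * t.2)%:R * (x 0 ^+ t.1.1.-1 * x 1 ^+ t.1.2 * x 2 ^+ t.2.-1)
     - (t.1.2 * t.1.2.-1)%:R * (x 0 ^+ t.1.1 * x 1 ^+ t.1.2.-2 * x 2 ^+ t.2)).
Proof.
move=> F4; have dd c d : F^`M(c)^`M(d) =
    \sum_(t <- exponents4) F@_(mon3 t) *: ('X_[mon3 t])^`M(c)^`M(d).
  rewrite {1}(quarticE F4) [_^`M(c)]raddf_sum [_^`M(d)]raddf_sum.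
  by apply: eq_bigr => t _ /=; rewrite !mderivZ.
rewrite /laplacian !dd -sumrB [LHS]raddf_sum.
apply: eq_bigr => -[[i j] k] _ /=; rewrite mevalB !mevalZ !mderiv2X -mulrBr.
congr (_ * _); rewrite !mon3E subn0 subn1 !natrM !mevalX !big_ord3E /=.
by rewrite !mnmBE !mnm1E !mon3E /= !subn0 !subn1.
Qed.

(** This parametrizes the conic [x_2^2 = 4 x_1 x_3], dual to [v_2^2 - v_1 v_3]. *)
Definition veronese (z : 'I_2 -> K) : 'I_3 -> K :=
  tnth [tuple z 0 ^+ 2; 2 * z 0 * z 1; z 1 ^+ 2].

Lemma lstar8_meval (F : {mpoly K[3]}) z : F \is 4.-homog ->
  (lstar F).1.1.@[z] = F.@[veronese z].
Proof.
move=> F4; rewrite (quartic_meval _ F4) /exponents4 !big_cons big_nil /= /veronese.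
rewrite !(tnth_nth 0) /= /mon3 /=.
rewrite /lstar /= !mevalD !addrA addr0.
repeat match goal with |- _ + _ = _ + _ => apply: (congr2 +%R) end.
all: rewrite mevalZ; congr (_ * _).
all: rewrite ?mevalM ?rmorphXn ?rmorph_nat /= ?mevalXU; ring.
Qed.

(** The factor can be read off from [x_1^3 x_3]: its image under [laplacian] is [3 x_1^2], while
    [lstar] gives [-3/14 z_1^4]. *)
Lemma lstar4_meval (F : {mpoly K[3]}) z : F \is 4.-homog ->
  (lstar F).1.2.@[z] = - 14^-1 * (laplacian F).@[veronese z].
Proof.
move=> F4; rewrite (laplacian_meval _ F4) mulr_sumr.
under eq_bigr do rewrite mulrCA.
rewrite /exponents4 !big_cons big_nil /veronese !(tnth_nth 0) /= /mon3 /=.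
rewrite /lstar /= !mevalD !addrA addr0.
repeat match goal with |- _ + _ = _ + _ => apply: (congr2 +%R) end.
all: rewrite mevalZ; congr (_ * _).
all: rewrite ?meval0 ?mevalZ ?mevalM ?rmorphXn ?rmorph_nat /= ?mevalXU.
all: by field; rewrite ?natr_eq0.
Qed.

Lemma form_tripleD (b c : triple K) :
  is_form_triple b -> is_form_triple c -> is_form_triple (b + c).
Proof. by move=> [b8 b4] [c8 c4]; split; [apply: (rpredD b8 c8) | apply: (rpredD b4 c4)]. Qed.

Lemma form_tripleZ (a : K) (b : triple K) : is_form_triple b -> is_form_triple (a *: b).
Proof. by move=> [b8 b4]; split; [apply: (rpredZ a b8) | apply: (rpredZ a b4)]. Qed.

Lemma homog_var i : 'X_i \is [in K[2], 1.-homog].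
Proof. by rewrite dhomogX /= mdeg1. Qed.

Lemma homog_varX i k : 'X_i ^+ k \is [in K[2], k.-homog].
Proof. by rewrite -[X in X.-homog]mul1n; apply/dhomogMn/homog_var. Qed.

Lemma homog_natr k : k%:R \is [in K[2], 0.-homog].
Proof. by apply: rpredMn; apply: dhomog1. Qed.

Lemma homog_mul d e k (p q : {mpoly K[2]}) : p \is d.-homog -> q \is e.-homog ->
  (d + e)%N = k -> p * q \is k.-homog.
Proof. by move=> pd qe <-; apply: dhomogM. Qed.

Local Ltac homog_monomial := lazymatch goal with |- is_true (in_mem ?p _) =>
  lazymatch p with
  | _ * _ => eapply homog_mul; [homog_monomial | homog_monomial | reflexivity]
  | _ ^+ _ => exact: homog_varX
  | _%:R => exact: homog_natr
  | _ => exact: homog_var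
  end end.

Lemma lstar_form (F : {mpoly K[3]}) : is_form_triple (lstar F).
Proof.
have Z d a (p : {mpoly K[2]}) : p \is d.-homog -> a *: p \is d.-homog by exact: rpredZ.
have O d : 0 \is [in K[2], d.-homog] by exact: rpred0.
rewrite /lstar; repeat apply: form_tripleD; apply: form_tripleZ; split.
all: rewrite [X in X \is _]/=; first [exact: O | idtac]; try apply: Z.
all: homog_monomial.
Qed.

(** The symmetric square of [S] in the basis [z_1^2], [2 z_1 z_2], [z_2^2] used by [veronese]. *)
Definition sym2 (S : 'M[K]_2) : 'M[K]_3 :=
  let: (a, b, c, d) := (S 0 0, S 0 1, S 1 0, S 1 1) in
  \matrix_(i, j) tnth (tnth [tuple [tuple a ^+ 2; a * b; b ^+ 2];
     [tuple 2 * a * c; a * d + b * c; 2 * b * d]; [tuple c ^+ 2; c * d; d ^+ 2]] i) j.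

Lemma det_mx3 (A : 'M[K]_3) : \det A =
  A 0 0 * (A 1 1 * A 2 2 - A 1 2 * A 2 1) - A 0 1 * (A 1 0 * A 2 2 - A 1 2 * A 2 0)
  + A 0 2 * (A 1 0 * A 2 1 - A 1 1 * A 2 0).
Proof.
have e j : \det (row' 0 (col' j A)) =
    A 1 (lift j 0) * A 2 (lift j 1) - A 1 (lift j 1) * A 2 (lift j 0).
  have l1 : lift 0 0 = 1 :> 'I_3 by apply: val_inj.
  have l2 : lift 0 1 = 2 :> 'I_3 by apply: val_inj.
  by rewrite [row' _ _]mx2E det_mx2 !mxE l1 l2.
have [l10 l11] : lift 1 0 = 0 :> 'I_3 /\ lift 1 1 = 2 :> 'I_3 by split; apply: val_inj.
have [l20 l21] : lift 2 0 = 0 :> 'I_3 /\ lift 2 1 = 1 :> 'I_3 by split; apply: val_inj.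
have [l00 l01] : lift 0 0 = 1 :> 'I_3 /\ lift 0 1 = 2 :> 'I_3 by split; apply: val_inj.
rewrite (expand_det_row _ 0) big_ord3E /cofactor !e l10 l11 l20 l21 l00 l01 /=.
rewrite !(addn0, add0n); ring.
Qed.

Lemma sym2E S : let A := sym2 S in
  [/\ A 0 0 = S 0 0 ^+ 2, A 0 1 = S 0 0 * S 0 1 & A 0 2 = S 0 1 ^+ 2] /\
  [/\ A 1 0 = 2 * S 0 0 * S 1 0, A 1 1 = S 0 0 * S 1 1 + S 0 1 * S 1 0
    & A 1 2 = 2 * S 0 1 * S 1 1] /\
  [/\ A 2 0 = S 1 0 ^+ 2, A 2 1 = S 1 0 * S 1 1 & A 2 2 = S 1 1 ^+ 2].
Proof. by rewrite /= !mxE. Qed.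

End Quartics.

(** * From stable quartics to stable triples *)

Section Stability.
Variable K : closedFieldType.
Hypothesis charK : [pchar K] =i pred0.

Lemma det_sym2 (S : 'M[K]_2) : \det S = 1 -> \det (sym2 S) = 1.
Proof.
rewrite {1}[S]mx2E det_mx2 det_mx3 => dS.
have [[-> -> ->] [[-> -> ->] [-> -> ->]]] := sym2E S.
by rewrite -[RHS](expr1n _ 3) -[X in _ = X ^+ 3]dS; ring.
Qed.

Lemma veronese_sym2 (S : 'M[K]_2) z :
  veronese (fun k => \sum_l S k l * z l) =1 fun i => \sum_j sym2 S i j * veronese z j.
Proof.
have [[e00 e01 e02] [[e10 e11 e12] [e20 e21 e22]]] := sym2E S.
apply: ord3P; rewrite big_ord3E /veronese !(tnth_nth 0) /= !big_ord2E /=.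
- by rewrite e00 e01 e02; ring.
- by rewrite e10 e11 e12; ring.
by rewrite e20 e21 e22; ring.
Qed.

Lemma laplacian_lsubst (F : {mpoly K[3]}) S : \det S = 1 ->
  laplacian (lsubst F (sym2 S)) = lsubst (laplacian F) (sym2 S).
Proof.
rewrite {1}[S]mx2E det_mx2 => dS; apply: mpoly_ext => v; set M := sym2 S.
pose G i k := (lsubst F^`M(i)^`M(k) M).@[v].
have dd a b : ((lsubst F M)^`M(a)^`M(b)).@[v] = \sum_i \sum_k M i a * M k b * G i k.
  rewrite mderiv_lsubst [_^`M(b)]raddf_sum [LHS]raddf_sum; apply: eq_bigr => i _ /=.
  rewrite mderivZ mderiv_lsubst mevalZ [_.@[v]]raddf_sum mulr_sumr; apply: eq_bigr => k _ /=.
  by rewrite mevalZ mulrA.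
have GC i k : G i k = G k i by rewrite /G mderiv_comm.
rewrite /laplacian mevalB !dd.
have -> : (lsubst (F^`M(0)^`M(2) - F^`M(1)^`M(1)) M).@[v] = G 0 2 - G 1 1.
  by rewrite meval_lsubst mevalB /G !meval_lsubst.
clear dd; clearbody G; rewrite !big_ord3E /= (GC 1 0) (GC 2 0) (GC 2 1).
have [[-> -> ->] [[-> -> ->] [-> -> ->]]] := sym2E S.
transitivity ((S 0 0 * S 1 1 - S 0 1 * S 1 0) ^+ 2 * (G 0 2 - G 1 1)); first by ring.
by rewrite dS expr1n mul1r.
Qed.

Lemma lstar_lsubst (F : {mpoly K[3]}) S : F \is 4.-homog -> \det S = 1 ->
  (lstar (lsubst F (sym2 S))).1.1 = lsubst (lstar F).1.1 S /\
  (lstar (lsubst F (sym2 S))).1.2 = lsubst (lstar F).1.2 S.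
Proof.
move=> F4 dS; have F4' := lsubst_dhomog (sym2 S) F4.
split; apply: mpoly_ext => v; rewrite meval_lsubst.
  rewrite !lstar8_meval // meval_lsubst.
  by apply: meval_eq => i; rewrite veronese_sym2.
rewrite !lstar4_meval // laplacian_lsubst // meval_lsubst; congr (_ * _).
by apply: meval_eq => i; rewrite veronese_sym2.
Qed.

Definition mon2 (a b : nat) : 'X_{1..2} := [multinom [tuple a; b]].

Lemma mon2E a b : (mon2 a b 0%R = a) * (mon2 a b 1%R = b).
Proof. by rewrite /mon2 !(mnm_nth 0%N). Qed.

Lemma mon2_eq a b c d : (mon2 a b == mon2 c d) = (a == c) && (b == d).
Proof.
apply/eqP/andP => [e|[/eqP-> /eqP->] //].
have := congr1 (fun m : 'X_{1..2} => (m 0, m 1)) e; rewrite !mon2E => -[-> ->].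
by rewrite !eqxx.
Qed.

Lemma meval_mon2 a b (z : 'I_2 -> K) : 'X_[mon2 a b].@[z] = z 0 ^+ a * z 1 ^+ b.
Proof. by rewrite mevalX big_ord2E /= !mon2E. Qed.

Lemma lstar8_coef (F : {mpoly K[3]}) a b : F \is 4.-homog ->
  (lstar F).1.1@_(mon2 a b) = \sum_(t <- exponents4) F@_(mon3 t) *
    (2 ^ t.1.2 * ((2 * t.1.1 + t.1.2 == a) && (t.1.2 + 2 * t.2 == b)))%:R.
Proof.
move=> F4; have -> : (lstar F).1.1 = \sum_(t <- exponents4)
    (F@_(mon3 t) * (2 ^ t.1.2)%:R) *: 'X_[mon2 (2 * t.1.1 + t.1.2)%N (t.1.2 + 2 * t.2)%N].
  apply: mpoly_ext => z; rewrite lstar8_meval // (quartic_meval _ F4) raddf_sum.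
  apply: eq_bigr => -[[i j] k] _ /=; rewrite mevalZ meval_mon2 /veronese !(tnth_nth 0) /=.
  rewrite -[RHS]mulrA; congr (_ * _).
  by rewrite natrX !exprMn !exprD; ring.
rewrite raddf_sum; apply: eq_bigr => t _ /=.
by rewrite mcoeffZ mcoeffX mon2_eq natrM mulrA.
Qed.

Lemma lstar4_coef (F : {mpoly K[3]}) a b : F \is 4.-homog ->
  (lstar F).1.2@_(mon2 a b) = - 14^-1 * \sum_(t <- exponents4) F@_(mon3 t) *
    ((t.1.1 * t.2 * 2 ^ t.1.2 *
        ((2 * t.1.1.-1 + t.1.2 == a) && (t.1.2 + 2 * t.2.-1 == b)))%:R
     - (t.1.2 * t.1.2.-1 * 2 ^ t.1.2.-2 *
        ((2 * t.1.1 + t.1.2.-2 == a) && (t.1.2.-2 + 2 * t.2 == b)))%:R).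
Proof.
move=> F4; have -> : (lstar F).1.2 = - 14^-1 *: \sum_(t <- exponents4) F@_(mon3 t) *:
    ((t.1.1 * t.2 * 2 ^ t.1.2)%:R *: 'X_[mon2 (2 * t.1.1.-1 + t.1.2)%N (t.1.2 + 2 * t.2.-1)%N]
   - (t.1.2 * t.1.2.-1 * 2 ^ t.1.2.-2)%:R *:
        'X_[mon2 (2 * t.1.1 + t.1.2.-2)%N (t.1.2.-2 + 2 * t.2)%N]).
  apply: mpoly_ext => z; rewrite lstar4_meval // (laplacian_meval _ F4) mevalZ [in RHS]raddf_sum.
  congr (_ * _); apply: eq_bigr => -[[i j] k] _ /=.
  rewrite mevalZ mevalB !mevalZ !meval_mon2 /veronese !(tnth_nth 0) /=; congr (_ * _).
  by rewrite !natrM !natrX !exprMn !exprD; ring.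
rewrite mcoeffZ raddf_sum; congr (_ * _); apply: eq_bigr => t _ /=.
by rewrite mcoeffZ mcoeffB !mcoeffZ !mcoeffX !mon2_eq !natrM.
Qed.

(** Six coefficients are concerned, of weight [m 0 - m 2] from 4 down to 1. Weights 4 and 3 have one
    each, read off from b_8; weights 2 and 1 have two each, tied by one equation from b_8 and an
    independent one from b_4. *)
Lemma degenerate_quartic (F : {mpoly K[3]}) : F \is 4.-homog -> degenerate (lstar F) ->
  forall m : 'X_{1..3}, (m 2%R < m 0%R)%N -> F@_m = 0.
Proof.
move=> F4 dF.
have d8 a b : (b < a)%N -> (lstar F).1.1@_(mon2 a b) = 0.
  by move=> ba; case: (dF (mon2 a b)) => //; rewrite !mon2E.
have d4 a b : (b < a)%N -> (lstar F).1.2@_(mon2 a b) = 0.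
  by move=> ba; case: (dF (mon2 a b)) => //; rewrite !mon2E.
have [c cE] : exists c : nat * nat * nat -> K, forall t, F@_(mon3 t) = c t.
  by exists (fun t => F@_(mon3 t)).
have h8 a b : (b < a)%N -> \sum_(t <- exponents4) c t *
    (2 ^ t.1.2 * ((2 * t.1.1 + t.1.2 == a) && (t.1.2 + 2 * t.2 == b)))%:R = 0.
  by move=> ba; rewrite -[RHS](d8 _ _ ba) lstar8_coef //; apply: eq_bigr => t _; rewrite cE.
have h4 a b : (b < a)%N -> \sum_(t <- exponents4) c t *
    ((t.1.1 * t.2 * 2 ^ t.1.2 *
        ((2 * t.1.1.-1 + t.1.2 == a) && (t.1.2 + 2 * t.2.-1 == b)))%:R
     - (t.1.2 * t.1.2.-1 * 2 ^ t.1.2.-2 *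
        ((2 * t.1.1 + t.1.2.-2 == a) && (t.1.2.-2 + 2 * t.2 == b)))%:R) = 0.
  move=> ba; have := d4 _ _ ba; rewrite lstar4_coef // => /eqP.
  rewrite mulf_eq0 oppr_eq0 invr_eq0 natr_eq0 //= => /eqP s0.
  by rewrite -[RHS]s0; apply: eq_bigr => t _; rewrite cE.
clear d8 d4 dF.
have c4 : all (fun t => (t.2 < t.1.1)%N ==> (c t == 0)) exponents4.
  have := h8 8 0 isT; have := h8 7 1 isT; have := h8 6 2 isT; have := h8 5 3 isT.
  have := h4 4 0 isT; have := h4 3 1 isT.
  clear h8 h4; rewrite /exponents4 !big_cons !big_nil /=.
  rewrite !(muln0, mulr0, muln1, subr0, sub0r, addr0, add0r) -?natrM ?expn1.
  move: (c (4, 0, 0)%N) (c (3, 1, 0)%N) (c (3, 0, 1)%N) (c (2, 2, 0)%N)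
    (c (2, 1, 1)%N) (c (1, 3, 0)%N) => c400 c310 c301 c220 c211 c130 e1 e2 e3 e4 e5 e6.
  (* The argument [k] is the predecessor of the factor: the eliminations below end in [28 * c130]
     and [14 * c220], with factors invertible in characteristic 0. *)
  have zero (x : K) k : x * k.+1%:R = 0 -> x = 0.
    by move/eqP; rewrite mulf_eq0 natr_eq0 // orbF => /eqP.
  have z130 : c130 = 0.
    apply: (zero _ 27%N); transitivity
      (2 * (c211 * 2 + c130 * (2 ^ 3)%:R) - (c211 * (2 * 2)%:R + c130 * (1 *- (3 * 2 * 2)))).
      by ring.
    by rewrite e1 e3; ring.
  have z220 : c220 = 0.
    apply: (zero _ 13%N); transitivity
      (3 * (c301 * (2 ^ 0)%:R + c220 * (2 * 2)%:R) - (c301 * 3 + c220 * -2)).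
      by ring.
    by rewrite e2 e4; ring.
  move: e1 e2 e5 e6; rewrite z130 z220 !mul0r !addr0.
  by move=> /zero-> /zero-> /zero-> /zero->; rewrite !eqxx.
move=> m lt_m; rewrite (quarticE F4) raddf_sum big1_seq // => t /andP[_ /(allP c4)].
rewrite [LHS]mcoeffZ mcoeffX cE; case: (mon3 t =P m) => [e|_ _]; last by rewrite mulr0.
move: lt_m; rewrite -e; case: t {e} => [[i j] k]; rewrite !mon3E /= => -> /= /eqP->.
by rewrite mul0r.
Qed.

Lemma nonzero_fresh (s : seq K) : exists2 t : K, t != 0 & t \notin s.
Proof.
have p0 : \prod_(c <- 0 :: s) ('X - c%:P) != 0 :> {poly K}.
  by rewrite monic_neq0 // monic_prod_XsubC.
have /closed_nonrootP [t] := p0; rewrite root_prod_XsubC inE negb_or => /andP[t0 ts].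
by exists t.
Qed.

Lemma SLequiv_trans n (f g h : {mpoly K[n]}) : SLequiv f g -> SLequiv g h -> SLequiv f h.
Proof.
move=> [S dS ->] [T dT ->]; exists (S *m T); last by rewrite lsubstM.
by rewrite det_mulmx dS dT mulr1.
Qed.

Definition torus3 (t : K) : 'M[K]_3 := diag_mx (\row_i tnth [tuple t^-1; 1; t] i).

Lemma det_torus3 t : t != 0 -> \det (torus3 t) = 1.
Proof.
move=> t0; rewrite det_diag big_ord3E /= !mxE !(tnth_nth 0) /= mulr1.
by rewrite mulVf.
Qed.

Lemma lsubst_torus3 (F : {mpoly K[3]}) t m : t != 0 ->
  (forall m : 'X_{1..3}, (m 2%R < m 0%R)%N -> F@_m = 0) ->
  (lsubst F (torus3 t))@_m = t ^+ (m 2%R - m 0%R) * F@_m.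
Proof.
move=> t0 F0; rewrite lsubst_diag_mx big_ord3E !(tnth_nth 0) /= expr1n mulr1.
have [lt|le] := ltnP (m 2) (m 0); first by rewrite F0 // !mulr0.
by rewrite -{1}(subnK le) exprD mulrCA exprVn mulVf ?mulr1 // expf_neq0.
Qed.

(* The limit of [F1] under the torus lies in the closed orbit of [F] and is fixed by
   the torus, so the stabilizer of [F] contains a conjugate of the torus. *)
Lemma stable_torus (F F1 : {mpoly K[3]}) : F \is 4.-homog -> stable F -> SLequiv F F1 ->
  ~ (forall m : 'X_{1..3}, (m 2%R < m 0%R)%N -> F1@_m = 0).
Proof.
move=> F4 [[I clI] [s fin]] [T0 dT0 F1E] z.
have F14 : F1 \is 4.-homog by rewrite F1E lsubst_dhomog.
pose w (i : 'I_#|{: monom 3 4}|) := (mon i 2%R - mon i 0%R)%N.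
pose Flim := of_coords (fun i => 0 ^+ w i * coords (d := 4) F1 i).
have [T dT FlimE] : SLequiv F Flim.
  apply/(clI _ (of_coords_homog _)) => p Ip.
  transitivity p.@[fun i => 0 ^+ w i * coords (d := 4) F1 i].
    by apply: meval_eq => i; rewrite of_coordsK.
  apply: torus_limit => t t0.
  have h : SLequiv F (lsubst F1 (torus3 t)).
    by exists (T0 *m torus3 t); rewrite ?lsubstM -?F1E // det_mulmx dT0 det_torus3 // mulr1.
  rewrite -[RHS](iffLR (clI _ (lsubst_dhomog _ F14)) h p Ip).
  by apply: meval_eq => i; rewrite /coords lsubst_torus3.
have fix_lim t : t != 0 -> lsubst Flim (torus3 t) = Flim.
  move=> t0; apply: (coords_inj (d := 4)); rewrite ?lsubst_dhomog ?of_coords_homog // => i.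
  rewrite /coords -/(mon i) lsubst_diag_mx big_ord3E !(tnth_nth 0) /= expr1n mulr1.
  have := of_coordsK (fun i => 0 ^+ w i * coords (d := 4) F1 i) i.
  rewrite /coords -/(mon i) -/Flim => ->; have [lt|le] := ltnP (mon i 2) (mon i 0).
    by rewrite z // !mulr0.
  have [e|w0] := posnP (w i); last by rewrite expr0n (gtn_eqF w0) mul0r mulr0.
  have -> : mon i 2%R = mon i 0%R by move: e le; rewrite /w; lia.
  by rewrite exprVn mulVf ?mul1r // expf_neq0.
have uT : T \in unitmx by rewrite unitmxE dT unitr1.
(* After conjugation by [T] the stabilizer element built from [torus3 t] has corner entry [t], so a
   [t] outside the corner entries of the conjugated list contradicts its completeness. *)
have [t t0 /negP[]] := nonzero_fresh [seq (invmx T *m A *m T) 2 2 | A <- s].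
apply/mapP; exists (T *m torus3 t *m invmx T).
  apply: fin; first by rewrite !det_mulmx det_inv dT det_torus3 // invr1 !mulr1.
  by rewrite !lsubstM -FlimE fix_lim // FlimE -lsubstM mulmxV // lsubst1.
rewrite !mulmxA mulVmx // mul1mx -mulmxA mulVmx // mulmx1.
by rewrite !mxE eqxx (tnth_nth 0) /= mulr1n.
Qed.

Lemma stable_lstar (F F' : {mpoly K[3]}) : F \is 4.-homog -> stable F -> SLequiv F F' ->
  stable_triple (lstar F').
Proof.
move=> F4 sF FF' S dS deg.
have F'4 : F' \is 4.-homog by have [T _ ->] := FF'; apply: lsubst_dhomog.
have [e8 e4] := lstar_lsubst F'4 dS.
apply: (@stable_torus F (lsubst F' (sym2 S))) => //.
  by apply: SLequiv_trans FF' _; exists (sym2 S); rewrite ?det_sym2.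
apply: degenerate_quartic; first exact: lsubst_dhomog.
by move=> m /deg; rewrite e8 e4.
Qed.

End Stability.

Theorem theorem3p1 (K : closedFieldType) (charK : [pchar K] =i pred0)
  (F : {mpoly K[3]}) (F_quartic : F \is 4.-homog)
  (F_stable : stable F) (I12_neq0 : I12 F != 0)
  (F' : {mpoly K[3]}) (F'_Z : inZ F') (F'_equiv : SLequiv F F')
  (b' : triple K) (b'_forms : is_form_triple b')
  (same_invariants : forall j : {mpoly K[n8 + n4 + 1]}, joint_invariant j ->
     j.@[tcoords b'] = j.@[tcoords (lstar F')]) :
  exists2 T : 'M[K]_2, \det T = 1 & b' = tsubst (lstar F') T.
Proof.
have bf : is_form_triple (lstar F') by apply: lstar_form.
have bS : stable_triple (lstar F') by apply: stable_lstar F'_equiv.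
have same := same_orbit_integral charK same_invariants.
have b'S := stable_fibre charK bf b'_forms bS same.
(* Separation puts the point with the finite orbit map into the closure of the other orbit, hence
   the stability of [b'] is used here and that of [lstar F'] in the closedness that follows. *)
have sep := orbit_separation charK (@theta_act1 K) (@theta_actM K)
  (stable_finite_map b'_forms b'S) (y := tcoords (lstar F')) same.
have [T dT TE] := orbit_closed (stable_finite_map bf bS) sep.
exists T => //; apply: tcoords_inj => // [|i]; first exact: tsubst_form.
by rewrite tcoords_tsubst // TE.
Qed.
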